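(* Let $X$ be a set and $\Phi\subseteq \mathbf{k}\mathfrak{M}(X)$ a set of multilinear operated polynomial identities (OPIs). Let $A=\mathbf{k}\mathcal{M}(Z)/I_A$ be a unital algebra with generating set $Z$, where $I_A$ is an ideal of $\mathbf{k}\mathcal{M}(Z)$. Let $\le$ be a monomial order on $\mathfrak{M}(Z)$ such that $\Phi$ is operated GS on $Z$ with respect to $\le$ (that is, $S_\Phi(Z)$ is an operated GS basis in $\mathbf{k}\mathfrak{M}(Z)$ with respect to $\le$), and let $G$ be a GS basis of $I_A$ in $\mathbf{k}\mathcal{M}(Z)$ with respect to the restriction of $\le$ to $\mathcal{M}(Z)$. Suppose that, for every OPI $\phi=\phi(x_1,\dots,x_n)\in\Phi$ with leading monomial $\overline{\phi}=\overline{\phi}(x_1,\dots,x_n)\in\mathfrak{M}(X)$: (i) $\overline{\phi}$ has no subword in $\mathcal{S}(X)\setminus X$; and (ii) for all $u_1,\dots,u_n\in\mathfrak{M}(Z)$, either $\phi(u_1,\dots,u_n)=0$ or the leading monomial of $\phi(u_1,\dots,u_n)$ with respect to $\le$ is $\overline{\phi}(u_1,\dots,u_n)$. Then $S_\Phi(Z)\cup G$ is an operated GS basis of $\langle S_\Phi(Z)\cup I_A\rangle_{\mathrm{uOpAlg}}$ in $\mathbf{k}\mathfrak{M}(Z)$ with respect to $\le$.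
   Context: $\mathbf{k}$ is a field. For a set $Z$, $\mathcal{S}(Z)$ is the free semigroup (nonempty words) and $\mathcal{M}(Z)$ the free monoid on $Z$; $\mathcal{S}(X)\setminus X$ is thus the set of words of length at least $2$ in $X$. A unital operated algebra is a unital $\mathbf{k}$-algebra with a $\mathbf{k}$-linear operator; an operated ideal is a (two-sided) ideal closed under the operator, and $\langle S\rangle_{\mathrm{uOpAlg}}$ is the operated ideal generated by $S$. $\mathfrak{M}(Z)$ is the free operated monoid on $Z$ (monoid with an arbitrary self-map), consisting of bracketed words: $\mathfrak{M}(Z)=\bigcup_n\mathfrak{M}_n$ with $\mathfrak{M}_0=\mathcal{M}(Z)$, $\mathfrak{M}_{n+1}=\mathcal{M}(Z\sqcup\lfloor\mathfrak{M}_n\rfloor)$ and operator $u\mapsto\lfloor u\rfloor$. Its linear span $\mathbf{k}\mathfrak{M}(Z)$ is the free unital operated algebra on $Z$, and $\mathbf{k}\mathcal{M}(Z)\subseteq\mathbf{k}\mathfrak{M}(Z)$. Each $u\ne1$ in $\mathfrak{M}(Z)$ is uniquely a product $u_1\cdots u_n$ with $u_i\in Z\cup\lfloor\mathfrak{M}(Z)\rfloor$; its breadth is $|u|=n$, and $|1|=0$. For a symbol $\star\notin Z$, $\mathfrak{M}^\star(Z)$ is the set of elements of $\mathfrak{M}(Z\cup\{\star\})$ in which $\star$ occurs exactly once; $q|_u$ is obtained from $q\in\mathfrak{M}^\star(Z)$ by replacing $\star$ by $u\in\mathfrak{M}(Z)$, extended linearly to $q|_s$ for $s\in\mathbf{k}\mathfrak{M}(Z)$.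 An element $u$ is a subword of $w$ if $w=q|_u$ for some $q\in\mathfrak{M}^\star(Z)$. A monomial order on $\mathfrak{M}(Z)$ is a well-order $\le$ such that $u<v$ implies $q|_u<q|_v$ for all $q\in\mathfrak{M}^\star(Z)$; a monomial order on $\mathcal{M}(Z)$ is a well-order with $u<v\Rightarrow wuz<wvz$. For $f\in\mathbf{k}\mathfrak{M}(Z)\setminus\mathbf{k}$, the leading monomial $\bar f$ is the largest monomial appearing in $f$; for $f\in\mathbf{k}$, $\bar f=1$. $f$ is monic if its leading coefficient is $1$; nonzero elements are made monic (monicized) by dividing by their leading coefficients. For monic $f,g$: if $w=\bar fu=v\bar g$ with $u,v,w\in\mathfrak{M}(Z)$ and $\max\{|\bar f|,|\bar g|\}<|w|<|\bar f|+|\bar g|$, then $(f,g)^{u,v}_w:=fu-vg$ is an intersection composition; if $w=\bar f=q|_{\bar g}$ with $q\in\mathfrak{M}^\star(Z)$, then $(f,g)^q_w:=f-q|_g$ is an inclusion composition. For $\mathcal{G}\subseteq\mathbf{k}\mathfrak{M}(Z)$ an element $f$ is trivial modulo $(\mathcal{G},w)$ if $f=\sum_i c_iq_i|_{s_i}$ (finite sum) with $c_i\in\mathbf{k}$, $q_i\in\mathfrak{M}^\star(Z)$, $s_i\in\mathcal{G}$, $q_i|_{\bar s_i}<w$. $\mathcal{G}$ is an operated GS (Gröbner–Shirshov) basis in $\mathbf{k}\mathfrak{M}(Z)$ if for all pairs of (monicized) elements of $\mathcal{G}$ every intersection and inclusion composition with respect to $w$ is trivial modulo $(\mathcal{G},w)$;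 it is an operated GS basis of an operated ideal $I$ if moreover it generates $I$ as an operated ideal. GS bases in $\mathbf{k}\mathcal{M}(Z)$, and of its ideals, are the usual ones for associative algebras (same definitions inside $\mathcal{M}(Z)$). An OPI is an element $\phi=\phi(x_1,\dots,x_n)\in\mathbf{k}\mathfrak{M}(X)$, $n\ge1$, $x_i\in X$; it is multilinear if it is linear in each $x_i$. For elements $r_1,\dots,r_n$ of a unital operated algebra, $\phi(r_1,\dots,r_n)$ denotes the result of substituting $r_i$ for $x_i$ (the operator replacing $\lfloor\ \rfloor$). Put $S_\Phi(Z):=\{\phi(u_1,\dots,u_n)\mid u_1,\dots,u_n\in\mathfrak{M}(Z),\ \phi(x_1,\dots,x_n)\in\Phi\}\subseteq\mathbf{k}\mathfrak{M}(Z)$. The leading monomial $\overline{\phi}\in\mathfrak{M}(X)$ of an OPI $\phi\in\Phi$ is taken with respect to a fixed monomial order on $\mathfrak{M}(X)$. *)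

(* Defs.v *)
From HB Require Import structures.
From mathcomp Require Import all_boot all_order all_algebra.
From mathcomp Require Import finmap wochoice.
From mathcomp.multinomials Require Import monalg.

Set Implicit Arguments.
Unset Strict Implicit.
Unset Printing Implicit Defensive.

Import GRing.Theory.

Local Open Scope ring_scope.

(* The free operated monoid on Z is the free monoid on Z + [M(Z)], so its     *)
(* elements are words whose letters are elements of Z or bracketed words.     *)

Inductive letter (Z : Type) : Type :=
| Var of Z
| Brk of seq (letter Z).

Section LetterInd.
Variables (Z : Type) (P : letter Z -> Prop) (Q : seq (letter Z) -> Prop).
Hypotheses (PVar : forall z, P (Var z)) (PBrk : forall w, Q w -> P (Brk w))
  (Qnil : Q [::]) (Qcons : forall a w, P a -> Q w -> Q (a :: w)).

Fixpoint letter_nested_ind (a : letter Z) : P a :=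
  match a with
  | Var z => PVar z
  | Brk w => PBrk ((fix word_ind w : Q w :=
      match w with
      | [::] => Qnil
      | a :: w => Qcons (letter_nested_ind a) (word_ind w)
      end) w)
  end.
End LetterInd.

Fixpoint letter_encode Z (a : letter Z) : GenTree.tree Z :=
  match a with
  | Var z => GenTree.Leaf z
  | Brk w => GenTree.Node 0 (map (@letter_encode Z) w)
  end.

Fixpoint letter_decode Z (t : GenTree.tree Z) : option (letter Z) :=
  match t with
  | GenTree.Leaf z => Some (Var z)
  | GenTree.Node _ ts => Some (Brk (pmap id (map (@letter_decode Z) ts)))
  end.

Lemma letter_encodeK Z : pcancel (@letter_encode Z) (@letter_decode Z).
Proof.
pose Q w :=
  pmap id (map (@letter_decode Z) (map (@letter_encode Z) w)) = w.
apply: (@letter_nested_ind _ _ Q); rewrite /Q //=.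
  by move=> w ->.
by move=> a w -> /= ->.
Qed.

HB.instance Definition _ (Z : choiceType) :=
  Choice.copy (letter Z) (pcan_type (@letter_encodeK Z)).

(* The breadth of w : opmonom Z is its length, fdeg w. *)
Notation opmonom Z := {fmonom (letter Z)}.

Section OperatedMonoid.
Context {Z : choiceType}.

Definition mvar (z : Z) : opmonom Z := FMonom [:: Var z].

Definition bracket (w : opmonom Z) : opmonom Z := FMonom [:: Brk (w : seq _)].

Definition emb (w : {fmonom Z}) : opmonom Z :=
  FMonom [seq Var z | z <- (w : seq Z)].

Fixpoint letter_occ (x : Z) (a : letter Z) : nat :=
  match a with
  | Var z => (z == x)
  | Brk w => sumn (map (letter_occ x) w)
  end.

Definition occ (x : Z) (w : opmonom Z) : nat :=
  sumn (map (letter_occ x) (w : seq _)).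

End OperatedMonoid.

Section Substitution.
Context {Z Y : choiceType} (h : Z -> opmonom Y).

Fixpoint letter_subst (a : letter Z) : seq (letter Y) :=
  match a with
  | Var z => h z
  | Brk w => [:: Brk (flatten (map letter_subst w))]
  end.

(* The morphism of operated monoids that extends h. *)
Definition subst (w : opmonom Z) : opmonom Y :=
  FMonom (flatten (map letter_subst (w : seq _))).

End Substitution.

(* Words in which the star, encoded as None : option Z, occurs exactly once. *)
Definition star_word (Z : choiceType) : Type :=
  {q : opmonom (option Z) | occ None q == 1}.

Definition op_plug (Z : choiceType) (q : star_word Z) (u : opmonom Z) :
    opmonom Z :=
  subst (fun o => if o is Some z then mvar z else u) (sval q).

Definition subword (Z : choiceType) (u w : opmonom Z) : Prop :=
  exists q : star_word Z, w = op_plug q u.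

(* In the free monoid, a context a*b is encoded as the pair (a, b). *)
Definition mon_plug (M : monomType) (q : M * M) (u : M) : M :=
  mmul (mmul q.1 u) q.2.

Definition lin_ext (K : fieldType) (M N : choiceType) (h : M -> N)
    (f : {malg K[M]}) : {malg K[N]} :=
  \sum_(m <- msupp f) << f@_m *g h m >>.

(* Groebner-Shirshov bases of a monoid algebra, for a given notion of contexts *)
(* q : C and of their instances plug q u. With op_plug this is the theory in   *)
(* the free operated algebra, with mon_plug the one in the free algebra.       *)
Section GroebnerShirshov.
Context (K : fieldType) (M : monomType) (br : M -> nat).
Context (C : Type) (plug : C -> M -> M) (le : rel M).

Implicit Types (f g s : {malg K[M]}) (u v w : M) (G : {malg K[M]} -> Prop).

Definition lt_of u v : bool := (u != v) && le u v.

Definition monomial_order : Prop :=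
  well_order le /\
  forall q u v, lt_of u v -> lt_of (plug q u) (plug q v).

(* The largest monomial of f, and 1 if f = 0. *)
Definition lead f : M :=
  if enum_fset (msupp f) is m :: ms
  then foldr (fun u v => if le u v then v else u) m ms else mone.

Definition lead_cf f : K := f@_(lead f).

Definition monicize f : {malg K[M]} := (lead_cf f)^-1 *: f.

Definition plug_lin (q : C) : {malg K[M]} -> {malg K[M]} := lin_ext (plug q).

Definition trivial_mod G w f : Prop :=
  exists (n : nat) (c : 'I_n -> K) (q : 'I_n -> C) (s : 'I_n -> {malg K[M]}),
    (forall i, G (s i) /\ lt_of (plug (q i) (lead (s i))) w) /\
    f = \sum_(i < n) c i *: plug_lin (q i) (s i).

Definition intersections_trivial G f g : Prop :=
  forall u v w, w = mmul (lead f) u -> w = mmul v (lead g) ->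
    (maxn (br (lead f)) (br (lead g)) < br w < br (lead f) + br (lead g))%N ->
    trivial_mod G w (f * << u >> - << v >> * g).

Definition inclusions_trivial G f g : Prop :=
  forall q w, w = lead f -> w = plug q (lead g) ->
    trivial_mod G w (f - plug_lin q g).

Definition is_GS G : Prop :=
  forall f g, G f -> G g -> f != 0 -> g != 0 ->
    intersections_trivial G (monicize f) (monicize g) /\
    inclusions_trivial G (monicize f) (monicize g).

End GroebnerShirshov.

Section Ideals.
Context (R : nzRingType).
Implicit Types (I S : R -> Prop) (P : R -> R).

Definition is_ideal I : Prop :=
  [/\ I 0, forall f g, I f -> I g -> I (f + g)
    & forall a f b, I f -> I (a * f * b)].

Definition is_operated_ideal P I : Prop :=
  is_ideal I /\ forall f, I f -> I (P f).

Definition ideal_gen S : R -> Prop :=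
  fun f => forall I, is_ideal I -> (forall s, S s -> I s) -> I f.

Definition operated_ideal_gen P S : R -> Prop :=
  fun f => forall I, is_operated_ideal P I -> (forall s, S s -> I s) -> I f.

End Ideals.

Section Algebras.
Context (K : fieldType) {Z : choiceType}.

Definition op_bracket : {malg K[opmonom Z]} -> {malg K[opmonom Z]} :=
  lin_ext bracket.

Definition emb_lin : {malg K[{fmonom Z}]} -> {malg K[opmonom Z]} :=
  lin_ext emb.

Definition emb_image (S : {malg K[{fmonom Z}]} -> Prop) :
    {malg K[opmonom Z]} -> Prop :=
  fun f => exists2 s, S s & f = emb_lin s.

Definition op_monomial_order (le : rel (opmonom Z)) : Prop :=
  monomial_order (@op_plug Z) le.

Definition is_op_GS (le : rel (opmonom Z))
    (G : {malg K[opmonom Z]} -> Prop) : Prop :=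
  is_GS (@fdeg _) (@op_plug Z) le G.

Definition op_GS_basis_of (le : rel (opmonom Z))
    (G I : {malg K[opmonom Z]} -> Prop) : Prop :=
  is_op_GS le G /\ forall f, I f <-> operated_ideal_gen op_bracket G f.

Definition GS_basis_of (le : rel {fmonom Z})
    (G I : {malg K[{fmonom Z}]} -> Prop) : Prop :=
  is_GS (@fdeg _) (@mon_plug {fmonom Z}) le G /\
  forall f, I f <-> ideal_gen G f.

End Algebras.

Section OPI.
Context (K : fieldType) {X : choiceType}.

(* phi = phi(x_1,...,x_n): the x_i are distinct, and no other element of X    *)
(* occurs in phi.                                                             *)
Definition is_opi n (x : n.-tuple X) (phi : {malg K[opmonom X]}) : Prop :=
  [/\ (0 < n)%N, uniq x
    & forall m y, m \in msupp phi -> (0 < occ y m)%N -> y \in x].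

Definition multilinear n (x : n.-tuple X) (phi : {malg K[opmonom X]}) : Prop :=
  forall i m, m \in msupp phi -> occ (tnth x i) m = 1%N.

Definition multilinear_opi n (x : n.-tuple X) phi : Prop :=
  is_opi x phi /\ multilinear x phi.

Context {Z : choiceType}.

(* m(u_1,...,u_n) and phi(u_1,...,u_n); the value of assign outside of the    *)
(* x_i is irrelevant.                                                         *)
Definition assign n (x : n.-tuple X) (u : n.-tuple (opmonom Z)) (y : X) :
    opmonom Z :=
  nth mone u (index y x).

Definition mon_eval n (x : n.-tuple X) (m : opmonom X)
    (u : n.-tuple (opmonom Z)) : opmonom Z :=
  subst (assign x u) m.

Definition opi_eval n (x : n.-tuple X) (phi : {malg K[opmonom X]})
    (u : n.-tuple (opmonom Z)) : {malg K[opmonom Z]} :=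
  lin_ext (fun m => mon_eval x m u) phi.

Definition S_of (Phi : {malg K[opmonom X]} -> Prop) :
    {malg K[opmonom Z]} -> Prop :=
  fun f => exists phi n (x : n.-tuple X) (u : n.-tuple (opmonom Z)),
    [/\ Phi phi, multilinear_opi x phi & f = opi_eval x phi u].

End OPI.

(* Main.v *)
Require Import Defs.
From HB Require Import structures.
From mathcomp Require Import all_boot all_order all_algebra perm.
From mathcomp Require Import finmap boolp wochoice.
From mathcomp.multinomials Require Import monalg.

Set Implicit Arguments.
Unset Strict Implicit.
Unset Printing Implicit Defensive.

Import GRing.Theory.

Local Open Scope ring_scope.

(** Let S be the set of all instances phi(u_1,...,u_n), let s be a monic element
    of G, viewed in the free operated algebra, and let bar phi be the leading
    monomial of phi. Compositions of two elements of S are trivial by hypothesis,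
    so three kinds of compositions remain.

    Two elements of G. The letters of their leading monomials lie in Z, so two
    occurrences of such monomials in an operated word either lie on the same
    level and meet as in the free monoid, or do not meet at all. Hence all
    ambiguities of G resolve in the free operated algebra (emb_ambiguities), and
    the composition-diamond lemma (composition_diamond) applies: an element of
    the operated ideal of G all of whose monomials are below w is trivial
    modulo (G, w).

    An inclusion of lead s in an instance f = phi(u). By (i), no two variables
    are adjacent in bar phi, so an occurrence of the Z-word lead s in
    bar phi(u) lies inside some u_i = c[lead s] (factor_in_variable). By
    multilinearity, y |-> phi(.., c[y], ..) extends to a linear map Psi with
    Psi(lead s) = f, and Psi(s) is a combination of elements d[s] for contexts
    d. Thus f - Psi(s) = Psi(lead s - s) is a combination of instances, whose
    leading monomials are smaller by (ii). Scale f to be monic. What is left of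
    the composition, the scaled Psi(s) minus the multiple of s in question, is
    in the operated ideal of G with all monomials below w, so that
    composition_diamond applies to it (comb_inclusion). The terms of phi other
    than bar phi may well have values above w that cancel, so this difference
    cannot be treated term by term. Inclusions of an instance in lead s only
    occur if bar phi is a single variable; then every word is the leading
    monomial of an instance and there is nothing to prove (single_var_all).

    An intersection of an instance f = phi(u) and s, say
    w = bar f u' = v (lead s). By (i) the overlap lies inside the value of the
    last letter x_i of bar phi. Let h be the instance obtained from f by
    replacing u_i with u_i u'. If h <> 0, its leading monomial is w, and the
    composition is the difference of the inclusion of lead s in h and the
    inclusion of bar f in h, which are trivial (comb_via).

    It remains to see that h <> 0 if f <> 0 (ev_extend_neq0). Give all letters
    of Z in u_1,...,u_n distinct labels. If a monomial w2 of the labelled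
    instance has the shape of its leading word w1, then w2 = sigma w1 for a
    permutation sigma of the labels. Replacing the labels by distinct brackets
    and permuting them by tau, hypothesis (ii) gives tau sigma w1 <= tau w1 for
    every tau; the choice of tau that minimizes tau w1 forces sigma w1 = w1
    (labelled_shape). So the coefficient of bar phi(u) in phi(u) is the
    coefficient of w1 in the labelled instance (coef_lead_labelled), and the
    latter is the same for f and h, because words over Z can be inserted next
    to a label and erased again by substitutions. *)

(** * Words and substitutions *)

(** Induction over words with a single motive: the letters of a word are
    handled together with the rest of the word. *)
Lemma word_ind (Z : Type) (Q : seq (letter Z) -> Prop) :
  Q [::] -> (forall z w, Q w -> Q (Var z :: w)) ->
  (forall v w, Q v -> Q w -> Q (Brk v :: w)) -> forall w, Q w.
Proof.
move=> Q0 QV QB.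
pose P (a : letter Z) := forall w, Q w -> Q (a :: w).
have PP a : P a.
  apply: (@letter_nested_ind Z P Q _ _ Q0 _ a) => [z w|v Qv w|b w Pb].
  - exact: QV.
  - exact: QB.
  - exact: Pb.
by elim=> // a w; apply: PP.
Qed.

Section Words.
Context {Z : choiceType}.
Implicit Types (u v w : seq (letter Z)).

(** Recursive arguments take words apart as sequences of letters; wocc and sub
    are occ and subst on sequences, and unfold by conversion. *)
Definition wocc (x : Z) w : nat := occ x (FMonom w).

Lemma wocc0 x : wocc x [::] = 0%N. Proof. by []. Qed.

Lemma wocc_var x z w : wocc x (Var z :: w) = ((z == x) + wocc x w)%N.
Proof. by []. Qed.

Lemma wocc_brk x v w : wocc x (Brk v :: w) = (wocc x v + wocc x w)%N.
Proof. by []. Qed.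

Lemma wocc_cat x v w : wocc x (v ++ w) = (wocc x v + wocc x w)%N.
Proof. by rewrite /wocc /occ map_cat sumn_cat. Qed.

Definition woccE := (wocc0, wocc_var, wocc_brk, wocc_cat).

End Words.

Section Sub.
Context {Z Y : choiceType}.
Implicit Types (h g : Z -> opmonom Y) (u v w : seq (letter Z)).

Definition sub h w : seq (letter Y) := flatten (map (letter_subst h) w).

Lemma substE h (w : opmonom Z) : subst h w = FMonom (sub h w).
Proof. by []. Qed.

Lemma sub0 h : sub h [::] = [::]. Proof. by []. Qed.

Lemma sub_var h z w : sub h (Var z :: w) = h z ++ sub h w.
Proof. by []. Qed.

Lemma sub_brk h v w : sub h (Brk v :: w) = Brk (sub h v) :: sub h w.
Proof. by []. Qed.

Lemma sub_cat h v w : sub h (v ++ w) = sub h v ++ sub h w.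
Proof. by rewrite /sub map_cat flatten_cat. Qed.

Definition subE := (sub0, sub_var, sub_brk, sub_cat).

Lemma eq_sub_occ h g w :
  (forall z, (0 < wocc z w)%N -> h z = g z) -> sub h w = sub g w.
Proof.
elim/word_ind: w => [//|z w IH|v w IHv IHw] hg; rewrite !subE.
  rewrite hg ?wocc_var ?eqxx // IH // => y y_w.
  by rewrite hg // wocc_var ltn_addl.
rewrite IHv ?IHw // => y y_w; apply: hg; rewrite wocc_brk.
  by rewrite ltn_addl.
by rewrite ltn_addr.
Qed.

Lemma eq_sub h g : h =1 g -> sub h =1 sub g.
Proof. by move=> hg w; apply: eq_sub_occ. Qed.

End Sub.

Lemma sub_comp (Z Y T : choiceType) (g : Y -> opmonom T) (h : Z -> opmonom Y) w :
  sub g (sub h w) = sub (fun z => subst g (h z)) w.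
Proof.
elim/word_ind: w => [//|z w IH|v w IHv IHw]; rewrite !subE ?IH //.
by rewrite IHv IHw.
Qed.

Lemma sub_mvar (Z : choiceType) (w : seq (letter Z)) : sub (@mvar Z) w = w.
Proof.
by elim/word_ind: w => [//|z w IH|v w IHv IHw]; rewrite !subE ?IH ?IHv ?IHw.
Qed.

Lemma subst_comp (Z Y T : choiceType) (g : Y -> opmonom T) (h : Z -> opmonom Y) w :
  subst g (subst h w) = subst (fun z => subst g (h z)) w.
Proof. by rewrite !substE sub_comp. Qed.

(** * Contexts *)

Section Contexts.
Context {Z : choiceType}.
Implicit Types (u v w : seq (letter Z)).

(** Words with one star, as a datatype: either the star lies on the top level,
    or it lies inside a bracket of the top level. This is the case analysis
    made whenever two occurrences in a word are compared. *)
Inductive context : Type :=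
| Hole of seq (letter Z) & seq (letter Z)
| Nest of seq (letter Z) & context & seq (letter Z).

Fixpoint fill (c : context) (u : seq (letter Z)) : seq (letter Z) :=
  match c with
  | Hole a b => a ++ u ++ b
  | Nest a c b => a ++ Brk (fill c u) :: b
  end.

Definition plugc (c : context) (u : opmonom Z) : opmonom Z := FMonom (fill c u).

Fixpoint ccomp (c d : context) : context :=
  match c with
  | Hole a b =>
      match d with
      | Hole a' b' => Hole (a ++ a') (b' ++ b)
      | Nest a' d b' => Nest (a ++ a') d (b' ++ b)
      end
  | Nest a c b => Nest a (ccomp c d) b
  end.

Lemma fill_comp c d u : fill (ccomp c d) u = fill c (fill d u).
Proof.
elim: c => [a b|a c IH b] /=; last by rewrite IH.
by case: d => [a' b'|a' d b'] /=; rewrite -!catA.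
Qed.

Lemma plugc_comp c d (u : opmonom Z) : plugc (ccomp c d) u = plugc c (plugc d u).
Proof. by rewrite /plugc fill_comp. Qed.

Definition some_word : seq (letter Z) -> seq (letter (option Z)) :=
  sub (fun z => mvar (Some z)).

Lemma wocc_some_word w : wocc None (some_word w) = 0%N.
Proof.
rewrite /some_word; elim/word_ind: w => [//|z w IH|v w IHv IHw].
  by rewrite subE wocc_cat IH.
by rewrite subE wocc_brk IHv IHw.
Qed.

Lemma sub_some_word (y : opmonom Z) w :
  sub (fun o => if o is Some z then mvar z else y) (some_word w) = w.
Proof. by rewrite /some_word sub_comp sub_mvar. Qed.

Fixpoint star_seq (c : context) : seq (letter (option Z)) :=
  match c with
  | Hole a b => some_word a ++ Var None :: some_word b
  | Nest a c b => some_word a ++ Brk (star_seq c) :: some_word b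
  end.

Lemma star_seq_occ c : occ None (FMonom (star_seq c)) == 1%N.
Proof.
rewrite -/(wocc None (star_seq c)).
elim: c => [a b|a c /eqP IH b] /=; rewrite woccE.
  by rewrite wocc_var !wocc_some_word.
by rewrite wocc_brk IH !wocc_some_word.
Qed.

Definition star_of (c : context) : star_word Z := 
  exist (fun q : opmonom (option Z) => occ None q == 1%N) _ (star_seq_occ c).

Lemma op_plug_star_of c (u : opmonom Z) : op_plug (star_of c) u = plugc c u.
Proof.
rewrite /op_plug substE /plugc /=; congr FMonom.
elim: c => [a b|a c IH b] /=; rewrite sub_cat sub_some_word.
  by rewrite sub_var sub_some_word.
by rewrite sub_brk sub_some_word IH.
Qed.

End Contexts.
Arguments context : clear implicits.

(** A variable that occurs once marks a position: putting d[u] for it is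
    plugging u into a fixed context. For d the bare star this turns words with
    one star into contexts; applied to the monomials of a multilinear identity
    it says that the identity is linear in what is put for x. *)
Lemma context_of_occ (X Z : choiceType) (h : X -> opmonom Z) x (d : context Z) w :
  wocc x w = 1%N -> exists c, forall u : opmonom Z,
    sub (fun y => if y == x then plugc d u else h y) w = fill c u.
Proof.
have const v : wocc x v = 0%N -> forall u : opmonom Z,
    sub (fun y => if y == x then plugc d u else h y) v = sub h v.
  move=> v0 u; apply: eq_sub_occ => y; case: eqP => // ->.
  by rewrite v0.
elim/word_ind: w => [//|y w IH|v w IHv IHw].
  rewrite wocc_var eq_sym; have [<- [w0]|yx w1] := eqVneq x y.
    exists (ccomp (Hole [::] (sub h w)) d) => u.
    by rewrite fill_comp sub_var eqxx /= const.
  have [c cE] := IH w1; exists (ccomp (Hole (h y) [::]) c) => u.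
  by rewrite fill_comp sub_var cE eq_sym (negbTE yx) /= cats0.
rewrite wocc_brk; case v1: (wocc x v) => [|n].
  move=> /IHw[c cE]; exists (ccomp (Hole [:: Brk (sub h v)] [::]) c) => u.
  by rewrite fill_comp sub_brk cE const //= cats0.
rewrite addSn => -[/eqP]; rewrite addn_eq0 => /andP[/eqP n0 /eqP w0].
have [|c cE] := IHv; first by rewrite v1 n0.
by exists (Nest [::] c (sub h w)) => u; rewrite sub_brk cE const.
Qed.

Lemma context_of_star (Z : choiceType) (q : star_word Z) :
  exists c, op_plug q =1 plugc c.
Proof.
case: q => [[q] q1']; have q1 := eqP q1'; rewrite /op_plug /=.
have [c cE] := context_of_occ (fun o => if o is Some z then mvar z else mone)
  (Hole [::] [::]) (q1 : wocc None q = 1%N).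
exists c => u; rewrite substE /plugc /= -cE; congr FMonom.
by apply: eq_sub => -[z|] //=; rewrite /plugc /= cats0; case: u.
Qed.

(** * Linear extension *)

Lemma malgU_scale (K : fieldType) (M : choiceType) (c : K) (m : M) :
  << c *g m >> = c *: << m >> :> {malg K[M]}.
Proof. by apply/malgP => k; rewrite mcoeffZ !mcoeffU mulrnAr mulr1. Qed.

Lemma malg_sumE (K : fieldType) (M : choiceType) (f : {malg K[M]}) :
  f = \sum_(m <- msupp f) f@_m *: << m >>.
Proof. by rewrite {1}[f]monalgE; apply: eq_bigr => m _; rewrite malgU_scale. Qed.

Section LinExt.
Context (K : fieldType) (M N : choiceType).
Implicit Types (h : M -> N) (f g : {malg K[M]}).

Lemma lin_extEw h f (d : {fset M}) : (msupp f `<=` d)%fset ->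
  lin_ext h f = \sum_(m <- d) << f@_m *g h m >>.
Proof.
move=> le; rewrite /lin_ext; apply/big_fset_incl => // x _ /mcoeff_outdom ->.
by rewrite monalgU0.
Qed.

Lemma lin_ext_is_linear h : linear (lin_ext (K := K) h).
Proof.
move=> a f g.
pose d := (msupp f `|` msupp g)%fset.
rewrite (@lin_extEw _ f d) ?fsubsetUl // (@lin_extEw _ g d) ?fsubsetUr //.
rewrite (@lin_extEw _ _ d); last first.
  by apply: fsubset_trans (msuppD_le _ _) _; rewrite fsetSU // msuppZ_le.
rewrite scaler_sumr -big_split /=; apply: eq_bigr => m _.
rewrite mcoeffD mcoeffZ monalgUD; congr (_ + _).
by apply/malgP => k; rewrite mcoeffZ !mcoeffU mulrnAr.
Qed.

HB.instance Definition _ h :=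
  GRing.isLinear.Build K {malg K[M]} {malg K[N]} _
    (@lin_ext K M N h) (lin_ext_is_linear h).

Lemma lin_extU h (c : K) m : lin_ext h << c *g m >> = << c *g h m >>.
Proof.
rewrite (@lin_extEw _ _ [fset m]%fset) ?msuppU_le //.
by rewrite big_seq_fset1 mcoeffUU.
Qed.

Lemma lin_extE h f : lin_ext h f = \sum_(m <- msupp f) f@_m *: << h m >>.
Proof. by apply: eq_bigr => m _; rewrite malgU_scale. Qed.

Lemma coef_lin_ext h f n :
  (lin_ext h f)@_n = \sum_(m <- msupp f | h m == n) f@_m.
Proof.
rewrite lin_extE raddf_sum [RHS]big_mkcond; apply: eq_bigr => m _ /=.
by rewrite mcoeffZ mcoeffU; case: eqP; rewrite ?mulr1 ?mulr0.
Qed.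

Lemma eq_lin_ext h1 h2 f : (forall m, m \in msupp f -> h1 m = h2 m) ->
  lin_ext h1 f = lin_ext h2 f.
Proof.
by move=> e; rewrite !lin_extE; apply: eq_big_seq => m /e ->.
Qed.

Lemma msupp_lin_ext h f n : n \in msupp (lin_ext h f) ->
  exists2 m, m \in msupp f & n = h m.
Proof.
rewrite -mcoeff_neq0 coef_lin_ext => n0.
have [/hasP[m mf /eqP e]|/hasPn no] := boolP (has (fun m => h m == n) (msupp f)).
  by exists m.
by case/eqP: n0; rewrite big_seq_cond big1 // => m /andP[/no/negbTE ->].
Qed.

(** If no other monomial of f collides with m under h, nothing is added to the
    coefficient of m. *)
Lemma coef_lin_ext_at h f m :
  (forall m', m' \in msupp f -> h m' = h m -> m' = m) ->
  (lin_ext h f)@_(h m) = f@_m.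
Proof.
move=> hI; rewrite coef_lin_ext big_mkcond.
have [mf|mf] := boolP (m \in msupp f); last first.
  rewrite mcoeff_outdom // big_seq big1 // => i i_f; case: eqP => // /(hI _ i_f) e.
  by rewrite -e i_f in mf.
rewrite (bigD1_seq m) ?fset_uniq //= eqxx big_seq_cond big1 ?addr0 // => i.
by case/andP=> /hI i_m ne; case: eqP => // /i_m e; rewrite e eqxx in ne.
Qed.

Lemma coef_lin_ext_inj h f m : injective h -> (lin_ext h f)@_(h m) = f@_m.
Proof. by move=> hI; apply: coef_lin_ext_at => m' _ /hI. Qed.

End LinExt.

Lemma lin_ext_comp (K : fieldType) (M N P : choiceType) (g : N -> P) (h : M -> N)
  (f : {malg K[M]}) : lin_ext g (lin_ext h f) = lin_ext (g \o h) f.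
Proof.
rewrite [lin_ext h f]lin_extE linear_sum lin_extE; apply: eq_bigr => m _.
by rewrite linearZ /= lin_extU.
Qed.

(** * Well-orders and leading monomials *)

Section WellOrder.
Context (M : monomType) (le : rel M) (wo : well_order le).
Local Notation lt := (lt_of le).

Let wc : wo_chain le predT.
Proof. exact: withinW. Qed.

Lemma wo_total u v : le u v || le v u.
Proof. exact: (wo_chainW wc). Qed.

Lemma wo_refl u : le u u.
Proof. by have := wo_total u u; rewrite orbb. Qed.

Lemma wo_anti u v : le u v -> le v u -> u = v.
Proof.
by move=> uv vu; apply: (wo_chain_antisymmetric wc) => //; rewrite uv vu.
Qed.

(** A minimum of the three elements exists; whichever it is, antisymmetry
    closes the cycle. *)
Lemma wo_trans u v w : le u v -> le v w -> le u w.
Proof.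
move=> uv vw.
have [|m [[m_in lb] _]] := @wo (mem [:: u; v; w]).
  by exists u; rewrite inE eqxx.
have lem t : t \in [:: u; v; w] -> le m t by exact: lb.
move: m_in; rewrite !inE => /or3P[] /eqP e; subst m.
- by apply: lem; rewrite !inE eqxx !orbT.
- by rewrite (wo_anti uv (lem u _)) // inE eqxx.
by rewrite -(wo_anti vw (lem v _)) // !inE eqxx orbT.
Qed.

Lemma wo_ltW u v : lt u v -> le u v. Proof. by case/andP. Qed.

Lemma wo_ltxx u : lt u u = false. Proof. by rewrite /lt_of eqxx. Qed.

Lemma wo_le_lt_trans u v w : le u v -> lt v w -> lt u w.
Proof.
move=> uv /andP[v_w vw]; rewrite /lt_of (wo_trans uv vw) andbT.
by apply: contraNneq v_w => e; subst w; rewrite (wo_anti vw uv).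
Qed.

Lemma wo_lt_le_trans u v w : lt u v -> le v w -> lt u w.
Proof.
move=> /andP[u_v uv] vw; rewrite /lt_of (wo_trans uv vw) andbT.
by apply: contraNneq u_v => e; subst w; rewrite (wo_anti uv vw).
Qed.

Lemma wo_lt_trans u v w : lt u v -> lt v w -> lt u w.
Proof. by move=> /wo_ltW; apply: wo_le_lt_trans. Qed.

Lemma wo_leNlt u v : ~~ lt u v -> le v u.
Proof.
rewrite /lt_of negb_and negbK => /orP[/eqP ->|]; first exact: wo_refl.
by have := wo_total u v; case: (le u v).
Qed.

Lemma wo_le_neq_lt u v : le u v -> u <> v -> lt u v.
Proof. by move=> uv /eqP; rewrite /lt_of uv => ->. Qed.

Lemma wo_ind (P : M -> Prop) :
  (forall u, (forall v, lt v u -> P v) -> P u) -> forall u, P u.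
Proof.
move=> step u; apply: contrapT => nPu.
have [|m [[m_in lb] _]] := @wo [pred v | ~~ `[< P v >]].
  by exists u; rewrite inE; apply/asboolPn.
move: m_in; rewrite inE => /asboolPn; apply; apply: step => v vm.
apply: contrapT => nPv; have /lb mv : v \in [pred v | ~~ `[< P v >]].
  by rewrite inE; apply/asboolPn.
by have := wo_lt_le_trans vm mv; rewrite wo_ltxx.
Qed.

End WellOrder.

Section Lead.
Context (K : fieldType) (M : monomType) (le : rel M) (wo : well_order le).
Local Notation lt := (lt_of le).
Local Notation lead := (lead le).
Implicit Types (f g : {malg K[M]}) (w m : M).

Lemma lead_supp_max f : f != 0 ->
  lead f \in msupp f /\ forall m, m \in msupp f -> le m (lead f).
Proof.
rewrite /lead => f0.
set b := (X in X \in _ /\ _).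
suff: b \in enum_fset (msupp f) /\ forall m, m \in enum_fset (msupp f) -> le m b.
  by [].
rewrite {}/b.
have : enum_fset (msupp f) <> [::].
  move=> e; case/eqP: f0; apply/malgP => k.
  by rewrite mcoeff0 mcoeff_outdom // -[_ \in _]/(k \in enum_fset (msupp f)) e.
case: (enum_fset _) => // m0 ms _.
elim: ms => [|a ms] /=.
  by split=> [|m]; rewrite mem_seq1 // => /eqP ->; apply: wo_refl.
move: (foldr _ _ _) => b [b_in b_max].
have mem_a m : (m \in [:: m0, a & ms]) = (m == a) || (m \in m0 :: ms).
  by rewrite !in_cons orbCA.
case: ifP => [ab|/negbT ab].
  split=> [|m]; rewrite mem_a ?b_in ?orbT //.
  by case/orP=> [/eqP ->|/b_max].
have ba : le b a by have := wo_total wo a b; rewrite (negbTE ab).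
split=> [|m]; rewrite mem_a ?eqxx // => /orP[/eqP ->|/b_max mb].
  exact: wo_refl.
exact: wo_trans ba.
Qed.

Lemma lead_supp f : f != 0 -> lead f \in msupp f.
Proof. by case/lead_supp_max. Qed.

Lemma le_lead f m : m \in msupp f -> le m (lead f).
Proof.
have [->|/lead_supp_max[_]] := eqVneq f 0; last exact.
by rewrite msupp0.
Qed.

Lemma lead_eq f w : w \in msupp f -> (forall m, m \in msupp f -> le m w) ->
  lead f = w.
Proof.
move=> wf mx; have f0 : f != 0 by apply: contraTneq wf => ->; rewrite msupp0.
by apply: (wo_anti wo); [apply/mx/lead_supp|apply: le_lead].
Qed.

Lemma lead_cf_neq0 f : f != 0 -> lead_cf le f != 0.
Proof. by move/lead_supp; rewrite /lead_cf mcoeff_neq0. Qed.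

Lemma leadZ (a : K) f : a != 0 -> lead (a *: f) = lead f.
Proof.
move=> a0; have [->|f0] := eqVneq f 0; first by rewrite scaler0.
have supp : msupp (a *: f) = msupp f by rewrite msuppZ (negbTE a0).
by apply: lead_eq; rewrite supp; [apply: lead_supp|move=> m; apply: le_lead].
Qed.

Lemma lead_monicize f : lead (monicize le f) = lead f.
Proof.
have [->|f0] := eqVneq f 0; first by rewrite /monicize scaler0.
by rewrite leadZ // invr_eq0 lead_cf_neq0.
Qed.

Lemma monicize_lead f : f != 0 -> (monicize le f)@_(lead f) = 1.
Proof. by move=> f0; rewrite mcoeffZ mulVf // lead_cf_neq0. Qed.

Definition lower w f := forall m, m \in msupp f -> lt m w.

Lemma lower0 w : lower w 0.
Proof. by move=> m; rewrite msupp0. Qed.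

Lemma lowerD w f g : lower w f -> lower w g -> lower w (f + g).
Proof.
by move=> lf lg m /(fsubsetP (msuppD_le _ _)); rewrite inE => /orP[/lf|/lg].
Qed.

Lemma lowerZ w (a : K) f : lower w f -> lower w (a *: f).
Proof. by move=> lf m /(fsubsetP (msuppZ_le _ _)) /lf. Qed.

Lemma lowerN w f : lower w f -> lower w (- f).
Proof. by rewrite -scaleN1r; apply: lowerZ. Qed.

Lemma lower_trans w w' f : le w w' -> lower w f -> lower w' f.
Proof. by move=> ww lf m /lf lm; apply: (wo_lt_le_trans wo) lm ww. Qed.

Lemma lower_coef w f : lower w f -> f@_w = 0.
Proof.
move=> lf; apply/eqP; rewrite mcoeff_eq0; apply/negP => /lf.
by rewrite wo_ltxx.
Qed.

Lemma lower_lead w f : f != 0 -> lower w f -> lt (lead f) w.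
Proof. by move=> f0; apply; apply: lead_supp. Qed.

Lemma lower_cancel f g w : (forall m, m \in msupp f -> le m w) ->
  (forall m, m \in msupp g -> le m w) -> f@_w = g@_w -> lower w (f - g).
Proof.
move=> mf mg e m mfg; apply: (wo_le_neq_lt).
  by move/(fsubsetP (msuppB_le _ _)): mfg; rewrite inE => /orP[/mf|/mg].
by move=> mw; move: mfg; rewrite -mcoeff_neq0 mcoeffB mw e subrr eqxx.
Qed.

Lemma monicize_lower f : f != 0 ->
  forall m, m \in msupp (monicize le f) -> m != lead f -> lt m (lead f).
Proof.
move=> f0 m mf /eqP; apply: wo_le_neq_lt.
by rewrite -lead_monicize; apply: le_lead.
Qed.

End Lead.

(** Strictly increasing maps of monomials are injective, so no terms merge and
    the leading term stays on top. *)
Lemma lead_lin_ext (K : fieldType) (M N : monomType) (leM : rel M) (leN : rel N)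
    (h : M -> N) (f : {malg K[M]}) :
  well_order leM -> well_order leN ->
  (forall u v, lt_of leM u v -> lt_of leN (h u) (h v)) -> f != 0 ->
  lead leN (lin_ext h f) = h (lead leM f) /\
  lead_cf leN (lin_ext h f) = lead_cf leM f.
Proof.
move=> woM woN mono f0.
have hI : injective h.
  move=> u v huv; apply/eqP; apply: contraT => u_v.
  have [uv|vu] := orP (wo_total woM u v).
    by have := mono u v; rewrite huv wo_ltxx /lt_of u_v uv => ->.
  by have := mono v u; rewrite huv wo_ltxx /lt_of eq_sym u_v vu => ->.
have e : lead leN (lin_ext h f) = h (lead leM f).
  apply: lead_eq => // [|n /msupp_lin_ext[m mf ->]].
    by rewrite -mcoeff_neq0 coef_lin_ext_inj // mcoeff_neq0 lead_supp.
  have [->|ne] := eqVneq m (lead leM f); first exact: wo_refl.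
  by apply: wo_ltW; apply: mono; rewrite /lt_of ne le_lead.
by split=> //; rewrite /lead_cf e coef_lin_ext_inj.
Qed.

(** * Composition-diamond lemma *)

Section Comb.
Context (K : fieldType) (M : monomType) (C : Type) (plug : C -> M -> M)
  (le : rel M).
Local Notation lt := (lt_of le).
Local Notation lead := (lead le).
Implicit Types (f g s : {malg K[M]}) (u v w : M) (G : {malg K[M]} -> Prop)
  (P : M -> Prop).

HB.instance Definition _ q :=
  GRing.Linear.copy (plug_lin (K := K) plug q) (lin_ext (plug q)).

(** Linear combinations of elements q[s], s in G, whose formal leading monomials
    q[lead s] satisfy P. For P the monomials below w this is triviality modulo
    (G, w), and for P always true it is the span of all q[s]; the
    composition-diamond lemma moves between such conditions. *)
Inductive comb G P : {malg K[M]} -> Prop :=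
| comb0 : comb G P 0
| comb_cons c q s f : G s -> P (plug q (lead s)) -> comb G P f ->
    comb G P (c *: plug_lin plug q s + f).

Lemma combD G P f g : comb G P f -> comb G P g -> comb G P (f + g).
Proof.
move=> cf cg; elim: cf => [|c q s f' Gs Ps _ IH]; first by rewrite add0r.
by rewrite -addrA; apply: comb_cons.
Qed.

Lemma combZ G P (a : K) f : comb G P f -> comb G P (a *: f).
Proof.
elim=> [|c q s f' Gs Ps _ IH]; first by rewrite scaler0; apply: comb0.
by rewrite scalerDr scalerA; apply: comb_cons.
Qed.

Lemma combN G P f : comb G P f -> comb G P (- f).
Proof. by rewrite -scaleN1r; apply: combZ. Qed.

Lemma combB G P f g : comb G P f -> comb G P g -> comb G P (f - g).
Proof. by move=> cf cg; apply/combD/combN. Qed.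

Lemma comb_gen G P q s : G s -> P (plug q (lead s)) ->
  comb G P (plug_lin plug q s).
Proof.
move=> Gs Ps; rewrite -[plug_lin _ _ _]addr0 -[plug_lin _ _ _]scale1r.
exact/comb_cons/comb0.
Qed.

Lemma comb_gen_monic G P q s : G s -> P (plug q (lead s)) ->
  comb G P (plug_lin plug q (monicize le s)).
Proof. by move=> Gs Ps; rewrite /monicize linearZ /=; apply/combZ/comb_gen. Qed.

Lemma comb_sum G P (I : eqType) (r : seq I) (Q : pred I) (F : I -> {malg K[M]}) :
  (forall i, i \in r -> Q i -> comb G P (F i)) ->
  comb G P (\sum_(i <- r | Q i) F i).
Proof.
move=> cF; rewrite big_seq_cond; elim/big_ind: _ => [|? ?|i /andP[]]; last exact: cF.
  exact: comb0.
exact: combD.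
Qed.

Lemma comb_sub G G' P P' f : (forall s, G s -> G' s) -> (forall w, P w -> P' w) ->
  comb G P f -> comb G' P' f.
Proof.
move=> sG sP; elim=> [|c q s f' Gs Ps _ IH]; first exact: comb0.
by apply: comb_cons IH; [apply: sG|apply: sP].
Qed.

Lemma trivial_modP G w f :
  trivial_mod plug le G w f <-> comb G (fun m => lt m w) f.
Proof.
split=> [[n [c [q [s [Gs ->]]]]]|].
  apply: comb_sum => i _ _; apply: combZ.
  by have [? ?] := Gs i; apply: comb_gen.
elim=> [|c0 q0 s0 f' Gs0 Ps0 _ [n [c [q [s [Gs ->]]]]]].
  by exists 0%N, (fun=> 0),
       (fun i : 'I_0 => False_rect C (elimF idP (ltn0 i) (ltn_ord i))), (fun=> 0);
     split=> [[]//|]; rewrite big_ord0.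
exists n.+1, (fun i => oapp c c0 (unlift ord0 i)),
  (fun i => oapp q q0 (unlift ord0 i)), (fun i => oapp s s0 (unlift ord0 i)).
split; first by move=> i; case: unliftP => [j|] _ //=.
rewrite big_ord_recl unlift_none /=; congr (_ + _).
by apply: eq_bigr => i _; rewrite liftK.
Qed.

End Comb.

Section CompositionDiamond.
Context (K : fieldType) (M : monomType) (C : Type) (plug : C -> M -> M)
  (le : rel M) (le_order : monomial_order plug le).
Local Notation lt := (lt_of le).
Local Notation lead := (lead le).
Local Notation comb := (comb plug le).
Let wo := le_order.1.
Implicit Types (f g s : {malg K[M]}) (u v w : M) (G : {malg K[M]} -> Prop)
  (P : M -> Prop).

Lemma plug_le q u v : le u v -> le (plug q u) (plug q v).
Proof.
move=> uv; have [->|ne] := eqVneq u v; first exact: wo_refl.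
by apply: wo_ltW; apply: le_order.2; rewrite /lt_of ne.
Qed.

Lemma plug_lin_le q s m : m \in msupp (plug_lin plug q s) ->
  le m (plug q (lead s)).
Proof. by case/msupp_lin_ext=> n ns ->; apply/plug_le/le_lead. Qed.

Lemma plug_lin_monic q s : s != 0 ->
  (plug_lin plug q (monicize le s))@_(plug q (lead s)) = 1.
Proof.
move=> s0; have ms0 : monicize le s != 0.
  by rewrite scaler_eq0 invr_eq0 negb_or lead_cf_neq0.
have [e] := lead_lin_ext wo wo (le_order.2 q) ms0.
rewrite /lead_cf e lead_monicize // => ->.
by rewrite monicize_lead.
Qed.

Lemma plug_lin_monic_le q s m : m \in msupp (plug_lin plug q (monicize le s)) ->
  le m (plug q (lead s)).
Proof. by rewrite -(lead_monicize wo s); apply: plug_lin_le. Qed.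

Lemma comb_lower G w f : comb G (fun m => lt m w) f -> lower le w f.
Proof.
elim=> [|c q s f' _ Ps _ IH]; first exact: lower0.
apply: lowerD => //; apply: lowerZ => m /plug_lin_le ms.
exact: wo_le_lt_trans Ps.
Qed.

(** Only finitely many formal leading monomials occur, so one of them bounds the
    others. *)
Lemma comb_bound G P f : comb G P f ->
  f = 0 \/ exists2 w, P w & comb G (fun m => le m w) f.
Proof.
elim=> [|c q s f' Gs Ps _ [->|[w Pw cf]]]; [by left|right..].
  exists (plug q (lead s)) => //; rewrite addr0.
  by apply/combZ/comb_gen => //; apply: wo_refl.
have [ws|sw] := orP (wo_total wo w (plug q (lead s))).
  exists (plug q (lead s)) => //; apply: comb_cons => //; first exact: wo_refl.
  by apply: comb_sub cf => // m mw; apply: wo_trans ws.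
by exists w => //; apply: comb_cons.
Qed.

(** Any two ways of reducing one monomial by G agree modulo G and smaller
    monomials. The condition is over all pairs of occurrences, not just the
    minimal overlaps of compositions. *)
Definition ambiguities_trivial G := forall q1 q2 s1 s2,
  G s1 -> G s2 -> s1 != 0 -> s2 != 0 -> plug q1 (lead s1) = plug q2 (lead s2) ->
  comb G (fun m => lt m (plug q1 (lead s1)))
    (plug_lin plug q1 (monicize le s1) - plug_lin plug q2 (monicize le s2)).

(** All summands with formal leading monomial w can be exchanged for multiples
    of one of them, at the price of smaller terms. Its coefficient is then the
    coefficient of w in f, that is 0. *)
Lemma comb_top G w f : ambiguities_trivial G ->
  comb G (fun m => le m w) f -> f@_w = 0 -> comb G (fun m => lt m w) f.
Proof.
move=> amb cf.
suff [//|[q [s [a [Gs s0 sw cfa]]]]] : comb G (fun m => lt m w) f \/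
    exists q s a, [/\ G s, s != 0, plug q (lead s) = w &
      comb G (fun m => lt m w) (f - a *: plug_lin plug q (monicize le s))].
  move=> fw0; have /lower_coef := comb_lower cfa.
  rewrite mcoeffB mcoeffZ fw0 -[X in _@_X]sw plug_lin_monic // mulr1 sub0r.
  by move/eqP; rewrite oppr_eq0 => /eqP a0; move: cfa; rewrite a0 scale0r subr0.
elim: cf => [|c q s f' Gs sw _ IH]; first by left; apply: comb0.
have [s0|s0] := eqVneq s 0; first by rewrite s0 linear0 scaler0 add0r.
have [e|ne] := eqVneq (plug q (lead s)) w; last first.
  have lsw : lt (plug q (lead s)) w by rewrite /lt_of ne.
  case: IH => [cf'|[q' [s' [a [Gs' s'0 sw' cf']]]]]; [left|right].
    exact: comb_cons.
  by exists q', s', a; split=> //; rewrite -addrA; apply: comb_cons.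
have sE : s = lead_cf le s *: monicize le s.
  by rewrite scalerA mulfV ?scale1r // lead_cf_neq0.
right; case: IH => [cf'|[q' [s' [a [Gs' s'0 sw' cf']]]]].
  exists q, s, (c * lead_cf le s); split=> //.
  by rewrite {1}sE linearZ /= scalerA addrAC subrr add0r.
exists q', s', (a + c * lead_cf le s); split=> //.
rewrite {1}sE linearZ /= scalerA scalerDl opprD [_ + f']addrC addrACA.
rewrite -scalerBr; apply: combD => //; apply: combZ.
by rewrite -e; apply: amb => //; rewrite e.
Qed.

(** If the formal leading monomials of a representation of f reach above w, those
    on top cancel, so comb_top lowers their bound; induction on the bound. *)
Theorem composition_diamond G w f : ambiguities_trivial G ->
  comb G (fun _ => True) f -> lower le w f -> comb G (fun m => lt m w) f.
Proof.
move=> amb /comb_bound[->|[v _ cf]] lf; first exact: comb0.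
elim/(wo_ind wo): v f cf lf => v IH f cf lf.
have [vw|/wo_leNlt wv] := boolP (lt v w).
  by apply: comb_sub cf => // m mv; apply: (wo_le_lt_trans wo) mv vw.
have /comb_bound[->|[v' v'v cf']] : comb G (fun m => lt m v) f.
- apply: comb_top => //; apply: lower_coef => //.
  exact: (lower_trans wo) (wv wo) lf.
- exact: comb0.
exact: IH cf' lf.
Qed.

(** Repeatedly subtracting a multiple of some q[s] that cancels the leading
    term terminates by well-foundedness. *)
Lemma comb_all G w f :
  (forall v, lt v w -> exists q s, [/\ G s, s != 0 & plug q (lead s) = v]) ->
  lower le w f -> comb G (fun m => lt m w) f.
Proof.
move=> all_lead lf.
suff H v : forall f, (lt v w \/ v = w) -> lower le v f -> comb G (fun m => lt m w) f.
  by apply: (H w) lf; right.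
elim/(wo_ind wo): v {f lf} => v IH f vw lf.
have [->|f0] := eqVneq f 0; first exact: comb0.
have fv := lower_lead wo f0 lf.
have fw : lt (lead f) w by case: vw => [|<- //]; apply: (wo_lt_trans wo) fv.
have [q [s [Gs s0 sf]]] := all_lead _ fw.
set g := plug_lin plug q (monicize le s).
rewrite -[f](subrK (lead_cf le f *: g)); apply: combD; last first.
  by apply/combZ/comb_gen_monic => //; rewrite sf.
apply: (IH (lead f)) => //; first by left.
apply: lower_cancel => [m|m|]; first exact: le_lead.
  by move/(fsubsetP (msuppZ_le _ _))/plug_lin_monic_le; rewrite sf.
by rewrite mcoeffZ -[X in g@_X]sf plug_lin_monic // mulr1.
Qed.

End CompositionDiamond.

(** Words with a star and contexts give the same notion of basis. *)
Lemma is_GS_sub (K : fieldType) (M : monomType) (br : M -> nat) (C C' : Type)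
    (plug : C -> M -> M) (plug' : C' -> M -> M) (le : rel M)
    (G : {malg K[M]} -> Prop) :
  (forall q, exists q', plug q =1 plug' q') ->
  (forall q', exists q, plug q =1 plug' q') ->
  is_GS br plug le G -> is_GS br plug' le G.
Proof.
move=> to from GS f g Gf Gg f0 g0; have [inter incl] := GS f g Gf Gg f0 g0.
have triv w e : trivial_mod plug le G w e -> trivial_mod plug' le G w e.
  rewrite !trivial_modP; elim=> [|c q s f' Gs sw _ IH]; first exact: comb0.
  have [q' qq'] := to q.
  have -> : plug_lin plug q s = plug_lin plug' q' s.
    by apply: eq_lin_ext => m _; apply: qq'.
  by apply: comb_cons IH => //; rewrite -qq'.
split=> [u v w wu wv ltw|q' w wf wq]; first exact/triv/inter.
have [q qq'] := from q'.
have <- : plug_lin plug q (monicize le g) = plug_lin plug' q' (monicize le g).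
  by apply: eq_lin_ext => m _; apply: qq'.
by apply/triv/incl => //; rewrite wq qq'.
Qed.

Lemma fmonomM (I : choiceType) (u v : {fmonom I}) :
  mmul u v = FMonom ((u : seq I) ++ v).
Proof. exact: fmmulE. Qed.

Lemma mulg_lin_ext (K : fieldType) (M : monomType) (f : {malg K[M]}) (m : M) :
  f * << m >> = lin_ext (fun u => mmul u m) f.
Proof.
rewrite lin_extE {1}[f]malg_sumE mulr_suml; apply: eq_bigr => u _.
by rewrite -scalerAl; congr (_ *: _); rewrite malgM_def fgmulUU mulr1.
Qed.

Lemma mulUg_lin_ext (K : fieldType) (M : monomType) (f : {malg K[M]}) (m : M) :
  << m >> * f = lin_ext (fun u => mmul m u) f.
Proof.
rewrite lin_extE {1}[f]malg_sumE mulr_sumr; apply: eq_bigr => u _.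
apply/malgP => k; rewrite malgM_def fgmulUg mcoeffZ.
have [->|c0] := eqVneq f@_u 0.
  by rewrite scale0r mul0r msupp0 big_seq_fset0 mcoeff0.
rewrite msuppZ (negbTE c0) msuppU oner_eq0 big_seq_fset1.
by rewrite mcoeffZ mcoeffUU mulr1 mul1r malgU_scale mcoeffZ.
Qed.

Lemma subr_cross (V : zmodType) (a b a' b' : V) :
  a + a' = b + b' -> a - b = b' - a'.
Proof.
by move=> e; apply/eqP; rewrite subr_eq addrAC [b' + b]addrC -e addrK.
Qed.

Section Cat.
Context {T : eqType}.
Implicit Types (a b v : seq T).

Lemma cat_eq_le a1 b1 a2 b2 : a1 ++ b1 = a2 ++ b2 -> (size a1 <= size a2)%N ->
  exists2 v, a2 = a1 ++ v & b1 = v ++ b2.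
Proof.
move=> e le12; exists (drop (size a1) a2).
  have : take (size a1) (a1 ++ b1) = take (size a1) (a2 ++ b2) by rewrite e.
  rewrite take_size_cat // takel_cat // => {1}->.
  by rewrite cat_take_drop.
have : drop (size a1) (a1 ++ b1) = drop (size a1) (a2 ++ b2) by rewrite e.
by rewrite drop_size_cat // drop_cat; case: ltngtP le12 => // ->; rewrite subnn drop_size drop0.
Qed.

End Cat.

Lemma map_eq_cat (S T : Type) (f : S -> T) l (a b : seq T) : map f l = a ++ b ->
  exists l1 l2, [/\ l = l1 ++ l2, a = map f l1 & b = map f l2].
Proof.
move=> e; exists (take (size a) l), (drop (size a) l).
by rewrite cat_take_drop map_take map_drop e take_size_cat ?drop_size_cat.
Qed.

(** * Two reductions of a monomial by a basis of the free algebra *)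

Section Plug.
Context (K : fieldType) (Z : choiceType) (le : rel (opmonom Z)).
Context (le_order : monomial_order (@plugc Z) le).
Local Notation lt := (lt_of le).
Local Notation lead := (lead le).
Local Notation comb := (comb (@plugc Z) le).
Local Notation lin := (plug_lin (@plugc Z)).
Let wo := le_order.1.
Implicit Types (G : {malg K[opmonom Z]} -> Prop) (s f : {malg K[opmonom Z]}).

Lemma linE c s : lin c s = \sum_(m <- msupp s) s@_m *: << plugc c m >>.
Proof. exact: lin_extE. Qed.

Lemma lin_comp c d s : lin c (lin d s) = lin (ccomp c d) s.
Proof.
by rewrite /plug_lin lin_ext_comp; apply: eq_lin_ext => m _ /=; rewrite plugc_comp.
Qed.

Lemma comb_plug G d w f : comb G (fun m => lt m w) f ->
  comb G (fun m => lt m (plugc d w)) (lin d f).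
Proof.
elim=> [|c q s f' Gs sw _ IH]; first by rewrite linear0; apply: comb0.
rewrite linearP /= lin_comp; apply: comb_cons => //.
by rewrite plugc_comp; apply: le_order.2.
Qed.

Lemma monic_sum (V : lmodType K) (F : opmonom Z -> V) s : s != 0 ->
  \sum_(m <- msupp (monicize le s)) (monicize le s)@_m *: F m =
  F (lead s) +
  \sum_(m <- msupp (monicize le s) | m != lead s) (monicize le s)@_m *: F m.
Proof.
move=> s0; have := monicize_lead wo s0; move: (lead s) (monicize _ s) => l t tl.
rewrite (bigD1_seq l) ?fset_uniq //= ?tl ?scale1r //.
by rewrite -mcoeff_neq0 tl oner_neq0.
Qed.

(** Both sides are the value at (s1, s2) of the bilinear extension of the
    two-hole context (x, y) |-> Dl(y)[x] = Dr(x)[y]. *)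
Lemma lin_exchange (Dl Dr : opmonom Z -> context Z) s1 s2 :
  (forall x y, plugc (Dl y) x = plugc (Dr x) y) ->
  \sum_(m <- msupp s2) s2@_m *: lin (Dl m) s1 =
  \sum_(m <- msupp s1) s1@_m *: lin (Dr m) s2.
Proof.
move=> D; transitivity (\sum_(y <- msupp s2) \sum_(x <- msupp s1)
    (s1@_x * s2@_y) *: << plugc (Dl y) x >> : {malg K[opmonom Z]}).
  apply: eq_bigr => y _; rewrite linE scaler_sumr; apply: eq_bigr => x _.
  by rewrite scalerA mulrC.
rewrite exchange_big; apply: eq_bigr => x _.
rewrite linE scaler_sumr; apply: eq_bigr => y _.
by rewrite scalerA D.
Qed.

(** Two occurrences that do not meet, described by a context with two holes.
    In the bilinear expression of lin_exchange, split off the leading monomial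
    of s2 on one side and that of s1 on the other: the two remaining sums are
    made of smaller multiples of s1, respectively of s2. *)
Lemma comb_disjoint G (Dl Dr : opmonom Z -> context Z) s1 s2 l1 l2 :
  (forall x y, plugc (Dl y) x = plugc (Dr x) y) ->
  G s1 -> G s2 -> s1 != 0 -> s2 != 0 -> lead s1 = l1 -> lead s2 = l2 ->
  comb G (fun m => lt m (plugc (Dl l2) l1))
    (lin (Dl l2) (monicize le s1) - lin (Dr l1) (monicize le s2)).
Proof.
move=> D G1 G2 s1_0 s2_0 <- <- {l1 l2}; set w := plugc _ _.
set t1 := monicize le s1; set t2 := monicize le s2.
have e1 := monic_sum (fun m => lin (Dl m) t1) s2_0.
have e2 := monic_sum (fun m => lin (Dr m) t2) s1_0.
have e := etrans (esym e1) (etrans (lin_exchange t1 t2 D) e2).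
rewrite (subr_cross e).
apply: combB; apply: comb_sum => m ms ne; apply: combZ.
  apply: (comb_gen_monic G2); rewrite -D /w.
  exact/le_order.2/(monicize_lower wo).
apply: (comb_gen_monic G1); rewrite /w !D.
exact/le_order.2/(monicize_lower wo).
Qed.

End Plug.

Section Emb.
Context {Z : choiceType}.
Implicit Types (u v w : {fmonom Z}).

Definition vars (l : seq Z) : seq (letter Z) := [seq Var z | z <- l].

Lemma vars_inj : injective vars.
Proof. by apply: inj_map => x y []. Qed.

Lemma embE w : emb w = FMonom (vars w). Proof. by []. Qed.

Lemma emb_inj : injective (@emb Z).
Proof. by move=> [u] [v] [/vars_inj ->]. Qed.

Lemma embM u v : emb (mmul u v) = FMonom (vars u ++ vars v).
Proof. by rewrite fmonomM embE /vars /= map_cat. Qed.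

Lemma emb_mon_plug (q : {fmonom Z} * {fmonom Z}) u :
  emb (mon_plug q u) = plugc (Hole (vars q.1) (vars q.2)) (emb u).
Proof.
by rewrite /mon_plug !fmonomM embE /= /vars !map_cat /plugc /= catA.
Qed.

Context (K : fieldType) (le : rel (opmonom Z)).
Context (le_order : monomial_order (@plugc Z) le).
Definition emb_le u v := le (emb u) (emb v).

Lemma emb_lt u v : lt_of emb_le u v = lt_of le (emb u) (emb v).
Proof. by rewrite /lt_of (inj_eq emb_inj). Qed.

Lemma emb_order : monomial_order (@mon_plug {fmonom Z}) emb_le.
Proof.
split=> [A [x Ax]|q u v]; last first.
  by rewrite !emb_lt !emb_mon_plug; apply: le_order.2.
have [|m [[]]] := le_order.1 [pred w | `[< exists2 a, a \in A & w = emb a >]].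
  by exists (emb x); rewrite inE; apply/asboolP; exists x.
rewrite inE => /asboolP[a Aa ->] lb _; exists a; split=> [|b [Ab lb']].
  by split=> // b Ab; apply: lb; rewrite inE; apply/asboolP; exists b.
apply: emb_inj; apply: (wo_anti le_order.1); last exact: lb'.
by apply: lb; rewrite inE; apply/asboolP; exists b.
Qed.

HB.instance Definition _ :=
  GRing.Linear.copy (@emb_lin K Z) (lin_ext (@emb Z)).

Lemma emb_lin_inj : injective (@emb_lin K Z).
Proof.
move=> f g e; apply/malgP => m.
rewrite -(coef_lin_ext_inj f m emb_inj) -(coef_lin_ext_inj g m emb_inj).
by rewrite -!/(emb_lin _) e.
Qed.

End Emb.

Lemma monicizeE (K : fieldType) (M : monomType) (le : rel M) (f : {malg K[M]}) :
  monicize le f = (lead_cf le f)^-1 *: f.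
Proof. by []. Qed.

(** * Two occurrences of words over Z in an operated word *)

Section Ambiguity.
Context (K : fieldType) (Z : choiceType) (le : rel (opmonom Z)).
Context (le_order : monomial_order (@plugc Z) le).
Context (G : {malg K[opmonom Z]} -> Prop).
Local Notation lt := (lt_of le).
Local Notation comb := (comb (@plugc Z) le G).
Local Notation lin := (plug_lin (@plugc Z)).
Implicit Types (t : {malg K[opmonom Z]}) (l u v : seq Z) (c d : context Z).

Definition word l : opmonom Z := FMonom (vars l).

(** What a pair of rewriting rules l1 -> t1 and l2 -> t2, given by words over Z,
    has to satisfy for the combinatorial analysis of two occurrences: disjoint
    occurrences, inclusions and overlaps resolve inside every context d. The
    elements t1 and t2 are variables here, so that the analysis does not
    depend on where the rules come from. *)
Definition resolvable t1 t2 l1 l2 : Prop :=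
  [/\ forall Dl Dr : opmonom Z -> context Z,
        (forall x y, plugc (Dl y) x = plugc (Dr x) y) ->
        comb (fun m => lt m (plugc (Dl (word l2)) (word l1)))
          (lin (Dl (word l2)) t1 - lin (Dr (word l1)) t2),
      forall d u v, l1 = v ++ l2 ++ u ->
        comb (fun m => lt m (plugc d (word l1)))
          (lin d t1 - lin (ccomp d (Hole (vars v) (vars u))) t2)
    & forall d u v, l1 ++ u = v ++ l2 ->
        (0 < size u)%N -> (0 < size v)%N -> (size v < size l1)%N ->
        comb (fun m => lt m (plugc d (word (l1 ++ u))))
          (lin (ccomp d (Hole [::] (vars u))) t1 -
           lin (ccomp d (Hole (vars v) [::])) t2)].

Definition ambiguity_trivial t1 t2 l1 l2 c1 c2 : Prop :=
  comb (fun m => lt m (plugc c1 (word l1))) (lin c1 t1 - lin c2 t2).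

Lemma ambiguity_sym t1 t2 l1 l2 c1 c2 :
  plugc c1 (word l1) = plugc c2 (word l2) ->
  ambiguity_trivial t2 t1 l2 l1 c2 c1 -> ambiguity_trivial t1 t2 l1 l2 c1 c2.
Proof. by rewrite /ambiguity_trivial => -> /combN; rewrite opprB. Qed.

Lemma ambiguity_disjoint t1 t2 l1 l2 c1 c2 (Dl Dr : opmonom Z -> context Z) :
  resolvable t1 t2 l1 l2 ->
  (forall x y, plugc (Dl y) x = plugc (Dr x) y) ->
  c1 = Dl (word l2) -> c2 = Dr (word l1) -> ambiguity_trivial t1 t2 l1 l2 c1 c2.
Proof. by case=> dis _ _ D -> ->; apply: dis. Qed.

(** Two occurrences on the top level are in one of the relative positions of
    the free monoid: disjoint, one inside the other, or properly overlapping. *)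
Lemma ambiguity_hole t1 t2 l1 l2 a1 b1 a2 b2 :
  resolvable t1 t2 l1 l2 -> resolvable t2 t1 l2 l1 ->
  plugc (Hole a1 b1) (word l1) = plugc (Hole a2 b2) (word l2) ->
  (size a1 <= size a2)%N ->
  ambiguity_trivial t1 t2 l1 l2 (Hole a1 b1) (Hole a2 b2).
Proof.
move=> r12 r21 [e] sz; have [v av {}e] := cat_eq_le e sz; subst a2 => {sz}.
have [sz|/ltnW sz] := leqP (size (vars l1)) (size v).
  have [m mv mb] := cat_eq_le e sz; subst v b1.
  apply: (ambiguity_disjoint (Dl := fun y => Hole a1 (m ++ y ++ b2))
    (Dr := fun x => Hole (a1 ++ x ++ m) b2) r12) => //.
  by move=> x y; rewrite /plugc /= -!catA.
have [o vo ob] := cat_eq_le (esym e) sz.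
have [v' [o' [e1 ev eo]]] := map_eq_cat vo; subst l1 v o => {vo sz}.
have [sz2|sz2] := leqP (size (vars l2)) (size (vars o')).
  have [u ou ub] := cat_eq_le ob sz2; subst b2.
  have [l2' [u' [e2 eo eu]]] := map_eq_cat ou; subst o' u => {ou sz2 ob e}.
  have e2 := vars_inj eo; subst l2' => {eo}.
  have [_ incl _] := r12.
  exact: (incl (Hole a1 b1) u' v').
have [u ou ub] := cat_eq_le (esym ob) (ltnW sz2); subst b1.
have [o'' [u' [e2 eo eu]]] := map_eq_cat ou; subst l2 u => {ou ob}.
have e2 := vars_inj eo; subst o'' => {eo}.
have u0 : (0 < size u')%N.
  by move: sz2; rewrite !size_map size_cat -{1}[size o']addn0 ltn_add2l.
case: (posnP (size v')) => [/size0nil v'0|v0].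
  subst v'; apply: ambiguity_sym; first by move: e; rewrite /plugc /= cats0 => ->.
  have [_ incl _] := r21.
  have := incl (Hole a1 b2) u' [::] erefl.
  by rewrite /ambiguity_trivial /= !cats0.
case: (posnP (size o')) => [/size0nil o'0|o0].
  subst o'; apply: (ambiguity_disjoint (Dl := fun y => Hole a1 (y ++ b2))
      (Dr := fun x => Hole (a1 ++ x) b2) r12) => //.
  - by move=> x y; rewrite /plugc /= -!catA.
  - by rewrite cats0.
have [_ _ inter] := r12.
have := inter (Hole a1 b2) u' v'.
rewrite -catA => /(_ erefl u0 v0).
rewrite size_cat -{1}[size v']addn0 ltn_add2l => /(_ o0).
rewrite /ambiguity_trivial /= cats0; apply: comb_sub => // m.
by rewrite /plugc /word /vars /= !map_cat -!catA.
Qed.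

(** A word over Z contains no bracket, so an occurrence on the top level cannot
    meet the bracket that contains the other occurrence. *)
Lemma ambiguity_hole_nest t1 t2 l1 l2 a1 b1 a2 c b2 :
  resolvable t1 t2 l1 l2 ->
  plugc (Hole a1 b1) (word l1) = plugc (Nest a2 c b2) (word l2) ->
  ambiguity_trivial t1 t2 l1 l2 (Hole a1 b1) (Nest a2 c b2).
Proof.
move=> r12 [].
have [sz e|sz /esym e] := leqP (size a1) (size a2); last first.
  rewrite -cat1s catA in e.
  have [|m am mb] := cat_eq_le e; first by rewrite size_cat addn1.
  subst a1 b2.
  apply: (ambiguity_disjoint (Dl := fun y => Hole ((a2 ++ [:: Brk (fill c y)]) ++ m) b1)
    (Dr := fun x => Nest a2 c (m ++ x ++ b1)) r12) => // x y.
  by rewrite /plugc /= -!catA.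
have [v av {}e] := cat_eq_le e sz; subst a2 => {sz}.
have [sz|sz] := leqP (size (vars l1)) (size v).
  have [m mv mb] := cat_eq_le e sz; subst v b1.
  apply: (ambiguity_disjoint (Dl := fun y => Hole a1 (m ++ Brk (fill c y) :: b2))
    (Dr := fun x => Nest (a1 ++ x ++ m) c b2) r12) => // x y.
  by rewrite /plugc /= -!catA.
exfalso; have [o vo ob] := cat_eq_le (esym e) (ltnW sz).
move: sz; rewrite vo size_cat; case: o vo ob => [|a o] vo /=.
  by rewrite addn0 ltnn.
by move=> [ea _] _; move: vo; rewrite -ea => /map_eq_cat[? [[|? ?] [_ _]]].
Qed.

(** Occurrences in different brackets are disjoint; for occurrences in the same
    bracket one removes the bracket. *)
Lemma ambiguity_resolved t1 t2 l1 l2 c1 c2 :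
  resolvable t1 t2 l1 l2 -> resolvable t2 t1 l2 l1 ->
  plugc c1 (word l1) = plugc c2 (word l2) ->
  ambiguity_trivial t1 t2 l1 l2 c1 c2.
Proof.
move=> r12 r21; elim: c1 c2 => [a1 b1|a1 c1 IH b1] [a2 b2|a2 c2 b2] e.
- have [sz|/ltnW sz] := leqP (size a1) (size a2); first exact: ambiguity_hole.
  by apply: (ambiguity_sym e); apply: (ambiguity_hole r21 r12 (esym e)).
- exact: ambiguity_hole_nest.
- by apply: (ambiguity_sym e); apply: (ambiguity_hole_nest r21 (esym e)).
case: (ltngtP (size a1) (size a2)) => sz.
- case: e => e; rewrite -cat1s catA in e.
  have [|m am mb] := cat_eq_le e; first by rewrite size_cat addn1.
  subst a2 b1.
  apply: (ambiguity_disjoint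
    (Dl := fun y => Nest a1 c1 (m ++ Brk (fill c2 y) :: b2))
    (Dr := fun x => Nest ((a1 ++ [:: Brk (fill c1 x)]) ++ m) c2 b2) r12) => // x y.
  by rewrite /plugc /= -!catA.
- case: e => /esym e; rewrite -cat1s catA in e.
  have [|m am mb] := cat_eq_le e; first by rewrite size_cat addn1.
  subst a1 b2.
  apply: (ambiguity_disjoint
    (Dl := fun y => Nest ((a2 ++ [:: Brk (fill c2 y)]) ++ m) c1 b1)
    (Dr := fun x => Nest a2 c2 (m ++ Brk (fill c1 x) :: b1)) r12) => // x y.
  by rewrite /plugc /= -!catA.
case: e => e; have [v av {}e] := cat_eq_le e (eq_leq sz).
have v0 : v = [::].
  apply: size0nil; have /eqP := congr1 size av.
  by rewrite size_cat sz -{1}[size a2]addn0 eqn_add2l => /eqP.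
subst v; rewrite cats0 in av; subst a2; case: e => ec eb; subst b2.
have {}ec : plugc c1 (word l1) = plugc c2 (word l2) by rewrite /plugc ec.
have nestE c t :
    lin (Nest a1 c b1) t = lin (ccomp (Nest a1 (Hole [::] [::]) b1) c) t.
  by apply: eq_lin_ext => m _; rewrite plugc_comp /plugc /= cats0.
have := comb_plug le_order (Nest a1 (Hole [::] [::]) b1) (IH _ ec).
rewrite linearB /= !lin_comp -!nestE.
by apply: comb_sub => // m; rewrite /plugc /= cats0.
Qed.

Lemma ambiguity_resolved_at t1 t2 l1 l2 c1 c2 m1 m2 :
  resolvable t1 t2 l1 l2 -> resolvable t2 t1 l2 l1 ->
  m1 = word l1 -> m2 = word l2 -> plugc c1 m1 = plugc c2 m2 ->
  comb (fun m => lt m (plugc c1 m1)) (lin c1 t1 - lin c2 t2).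
Proof. by move=> r12 r21 -> ->; apply: ambiguity_resolved. Qed.

End Ambiguity.

Section EmbBasis.
Context (K : fieldType) (Z : choiceType) (le : rel (opmonom Z)).
Context (le_order : monomial_order (@plugc Z) le).
Context (G : {malg K[{fmonom Z}]} -> Prop).
Context (G_GS : is_GS (@fdeg _) (@mon_plug {fmonom Z}) (emb_le le) G).
Local Notation lt := (lt_of le).
Local Notation lead := (lead le).
Local Notation comb := (comb (@plugc Z) le).
Local Notation lin := (plug_lin (@plugc Z)).
Local Notation eG := (emb_image G).
Local Notation eord := (emb_order le_order).
Let wo := le_order.1.
Let ewo := eord.1.
Implicit Types (g : {malg K[{fmonom Z}]}).

Lemma emb_lin_eq0 g : (emb_lin g == 0) = (g == 0).
Proof.
apply/eqP/eqP => [e|->]; last exact: linear0.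
by apply: emb_lin_inj; rewrite e /emb_lin linear0.
Qed.

Lemma emb_lin_neq0 g : emb_lin g != 0 -> g != 0.
Proof. by rewrite emb_lin_eq0. Qed.

Lemma emb_lt_mono u v : lt_of (emb_le le) u v -> lt (emb u) (emb v).
Proof. by rewrite emb_lt. Qed.

Lemma lead_emb g : g != 0 -> lead (emb_lin g) = emb (Defs.lead (emb_le le) g).
Proof. by move=> g0; case: (lead_lin_ext ewo wo emb_lt_mono g0). Qed.

Lemma monicize_emb g : g != 0 ->
  monicize le (emb_lin g) = emb_lin (monicize (emb_le le) g).
Proof.
move=> g0; rewrite !monicizeE /emb_lin linearZ /=.
by case: (lead_lin_ext ewo wo emb_lt_mono g0) => _ ->.
Qed.

Lemma lin_emb (q : {fmonom Z} * {fmonom Z}) g : lin (Hole (vars q.1) (vars q.2)) (emb_lin g) =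
  emb_lin (plug_lin (@mon_plug {fmonom Z}) q g).
Proof.
rewrite /plug_lin /emb_lin !lin_ext_comp; apply: eq_lin_ext => m _.
by rewrite [RHS]emb_mon_plug.
Qed.

Lemma emb_mulr g (m : {fmonom Z}) :
  emb_lin (g * << m >>) = lin (Hole [::] (vars m)) (emb_lin g).
Proof.
rewrite mulg_lin_ext /plug_lin /emb_lin !lin_ext_comp; apply: eq_lin_ext => x _.
by rewrite /= embM /plugc.
Qed.

Lemma emb_mull g (m : {fmonom Z}) :
  emb_lin (<< m >> * g) = lin (Hole (vars m) [::]) (emb_lin g).
Proof.
rewrite mulUg_lin_ext /plug_lin /emb_lin !lin_ext_comp; apply: eq_lin_ext => x _.
by rewrite /= embM /plugc /= cats0.
Qed.

(** Triviality in the free algebra is inherited by the free operated algebra,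
    because a context of the free monoid is a context with its star on the top
    level. *)
Lemma comb_emb w g :
  trivial_mod (@mon_plug {fmonom Z}) (emb_le le) G w g ->
  comb eG (fun m => lt m (emb w)) (emb_lin g).
Proof.
move/trivial_modP; elim=> [|c q s f' Gs sw _ IH].
  by rewrite linear0; apply: comb0.
have -> : emb_lin (c *: plug_lin (@mon_plug {fmonom Z}) q s + f') =
    c *: lin (Hole (vars q.1) (vars q.2)) (emb_lin s) + emb_lin f'.
  by rewrite lin_emb linearP.
have [s0|s0] := eqVneq s 0.
  by rewrite s0 !linear0 add0r.
apply: comb_cons IH; first by exists s.
by rewrite lead_emb // -emb_mon_plug; apply: emb_lt_mono.
Qed.

Lemma emb_resolvable_monic h1 h2 t1 t2 (l1 l2 : {fmonom Z}) :
  Defs.lead (emb_le le) h1 = l1 -> Defs.lead (emb_le le) h2 = l2 ->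
  t1 = emb_lin h1 -> t2 = emb_lin h2 ->
  intersections_trivial (@fdeg _) (@mon_plug {fmonom Z}) (emb_le le) G h1 h2 ->
  inclusions_trivial (@mon_plug {fmonom Z}) (emb_le le) G h1 h2 ->
  (forall Dl Dr : opmonom Z -> context Z,
     (forall x y, plugc (Dl y) x = plugc (Dr x) y) ->
     comb eG (fun m => lt m (plugc (Dl (word l2)) (word l1)))
       (lin (Dl (word l2)) t1 - lin (Dr (word l1)) t2)) ->
  resolvable le eG t1 t2 l1 l2.
Proof.
move=> e1 e2 -> -> inter incl dis; split=> // [d u v e|d u v e u0 v0 vl].
  have := comb_emb (incl (FMonom v, FMonom u) l1 (esym e1) _).
  rewrite e2 /mon_plug !fmonomM /= -catA -e => /(_ (esym (fmK l1))).
  move/(comb_plug le_order d).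
  by rewrite linearB /= -(lin_emb (FMonom v, FMonom u)) linearB /= lin_comp.
have := inter (FMonom u) (FMonom v) (FMonom (l1 ++ u)).
rewrite e1 e2 !fmonomM /= => /(_ erefl).
have se := congr1 size e; rewrite !size_cat in se.
rewrite e => /(_ erefl).
have -> : (maxn (fdeg l1) (fdeg l2) < fdeg (FMonom (v ++ l2)) < fdeg l1 + fdeg l2)%N.
  rewrite /fdeg size_cat gtn_max -{1}se -{1}[size l1]addn0 ltn_add2l u0.
  by rewrite -{1}[size l2]add0n !ltn_add2r v0 vl.
move=> /(_ erefl) /comb_emb /(comb_plug le_order d) H.
have E : lin d (emb_lin (h1 * << FMonom u >> - << FMonom v >> * h2)) =
    lin (ccomp d (Hole [::] (vars u))) (emb_lin h1) -
    lin (ccomp d (Hole (vars v) [::])) (emb_lin h2).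
  have eB := etrans (linearB (@emb_lin K Z) _ _)
    (congr2 (fun x y => x - y) (emb_mulr h1 (FMonom u)) (emb_mull h2 (FMonom v))).
  apply: etrans (congr1 (lin d) eB) (etrans (linearB (lin d) _ _) _).
  exact: (congr2 (fun x y => x - y) (lin_comp d (Hole [::] (vars u)) (emb_lin h1))
    (lin_comp d (Hole (vars v) [::]) (emb_lin h2))).
by rewrite -E.
Qed.

Lemma emb_resolvable g1 g2 : G g1 -> G g2 -> g1 != 0 -> g2 != 0 ->
  resolvable le eG (monicize le (emb_lin g1)) (monicize le (emb_lin g2))
    (Defs.lead (emb_le le) g1) (Defs.lead (emb_le le) g2).
Proof.
move=> G1 G2 g1_0 g2_0.
have [inter incl] := G_GS G1 G2 g1_0 g2_0.
have eg1 : emb_lin g1 != 0 by rewrite emb_lin_eq0.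
have eg2 : emb_lin g2 != 0 by rewrite emb_lin_eq0.
have eG1 : eG (emb_lin g1) by exists g1.
have eG2 : eG (emb_lin g2) by exists g2.
apply: (emb_resolvable_monic (lead_monicize ewo g1) (lead_monicize ewo g2)
  (monicize_emb g1_0) (monicize_emb g2_0) inter incl).
move=> Dl Dr D.
exact: (comb_disjoint le_order D eG1 eG2 eg1 eg2 (lead_emb g1_0) (lead_emb g2_0)).
Qed.

(** The compositions of a basis of the free algebra cover all ambiguities that
    its leading monomials have among bracketed words. *)
Lemma emb_ambiguities : ambiguities_trivial (@plugc Z) le eG.
Proof.
move=> c1 c2 s1 s2 [g1 G1 ->] [g2 G2 ->] eg1 eg2 e.
have g1_0 := emb_lin_neq0 eg1.
have g2_0 := emb_lin_neq0 eg2.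
exact: (ambiguity_resolved_at le_order (emb_resolvable G1 G2 g1_0 g2_0)
  (emb_resolvable G2 G1 g2_0 g1_0) (lead_emb g1_0) (lead_emb g2_0) e).
Qed.

End EmbBasis.

(** * Labelled words *)

Definition relabel (Z Y : choiceType) (f : Z -> Y) (w : seq (letter Z)) :
    seq (letter Y) :=
  sub (fun z => mvar (f z)) w.

Section Relabel.
Context {Z Y : choiceType}.
Implicit Types (f : Z -> Y) (w : seq (letter Z)).

Lemma relabel_var f z w : relabel f (Var z :: w) = Var (f z) :: relabel f w.
Proof. by []. Qed.

Lemma relabel_brk f v w :
  relabel f (Brk v :: w) = Brk (relabel f v) :: relabel f w.
Proof. by []. Qed.

Lemma relabel_cat f v w : relabel f (v ++ w) = relabel f v ++ relabel f w.
Proof. exact: sub_cat. Qed.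

Definition relabelE := (relabel_var, relabel_brk, relabel_cat).

Lemma relabel_eq0 f w : relabel f w = [::] -> w = [::].
Proof. by case: w => [|[]]. Qed.

Lemma eq_relabel f g w : (forall z, (0 < wocc z w)%N -> f z = g z) ->
  relabel f w = relabel g w.
Proof. by move=> fg; apply: eq_sub_occ => z /fg ->. Qed.

Lemma relabel_split f w (a b : seq (letter Y)) : relabel f w = a ++ b ->
  exists w1 w2, [/\ w = w1 ++ w2, relabel f w1 = a & relabel f w2 = b].
Proof.
elim: w a => [|l w IH] [|c a]; try by exists [::], [::].
- by move=> /= e; exists [::], (l :: w).
have -> : relabel f (l :: w) = head c (relabel f [:: l]) :: relabel f w.
  by case: l.
case=> <- /IH[w1 [w2 [-> <- <-]]]; exists (l :: w1), w2; split=> //.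
by case: l.
Qed.

Lemma wocc_relabel f z w : injective f -> wocc (f z) (relabel f w) = wocc z w.
Proof.
move=> fI; elim/word_ind: w => [//|y w IH|v w IHv IHw]; rewrite relabelE.
  by rewrite !wocc_var IH (inj_eq fI).
by rewrite !wocc_brk IHv IHw.
Qed.

Lemma wocc_relabel_codom f y w : (0 < wocc y (relabel f w))%N ->
  exists z, f z = y.
Proof.
elim/word_ind: w => [//|z w IH|v w IHv IHw]; rewrite relabelE.
  by rewrite wocc_var; case: eqP => [<- _|_ /IH //]; exists z.
by rewrite wocc_brk addn_gt0 => /orP[/IHv|/IHw].
Qed.

Lemma wocc_relabel0 f y w : (forall z, f z <> y) -> wocc y (relabel f w) = 0%N.
Proof.
move=> nf; apply/eqP; rewrite -leqn0 leqNgt; apply/negP.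
by case/wocc_relabel_codom => z /nf.
Qed.

Lemma wocc_sub (h : Z -> opmonom Y) (vs : seq Z) w y : uniq vs ->
  (forall z, (0 < wocc z w)%N -> z \in vs) ->
  wocc y (sub h w) = (\sum_(z <- vs) wocc z w * wocc y (h z))%N.
Proof.
move=> vsU; elim/word_ind: w => [|z w IH|v w IHv IHw] sub_vs.
- by rewrite big1 // => z _; rewrite mul0n.
- rewrite sub_var wocc_cat IH; last first.
    by move=> x xw; apply: sub_vs; rewrite wocc_var ltn_addl.
  have z_vs : z \in vs by apply: sub_vs; rewrite wocc_var eqxx.
  under [RHS]eq_bigr do rewrite wocc_var mulnDl.
  rewrite big_split /=; congr (_ + _)%N.
  rewrite (bigD1_seq z) //= eqxx mul1n big1 ?addn0 // => x.
  by rewrite eq_sym => /negbTE ->.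
rewrite sub_brk wocc_brk IHv ?IHw.
- by rewrite -big_split /=; apply: eq_bigr => z _; rewrite wocc_brk mulnDl.
- by move=> z zw; apply: sub_vs; rewrite wocc_brk ltn_addl.
by move=> z zv; apply: sub_vs; rewrite wocc_brk ltn_addr.
Qed.

End Relabel.

Lemma relabel_comp (Z Y T : choiceType) (g : Y -> T) (f : Z -> Y) w :
  relabel g (relabel f w) = relabel (g \o f) w.
Proof. exact: sub_comp. Qed.

Definition sum_fun (A B C : Type) (f : A -> C) (g : B -> C) (t : A + B) : C :=
  match t with inl a => f a | inr b => g b end.

Lemma label_word (Z : choiceType) (w : seq (letter Z)) :
  exists (T : finType) (k : T -> Z) (w' : seq (letter T)),
    relabel k w' = w /\ forall t, wocc t w' = 1%N.
Proof.
have step (T1 T2 : finType) (k1 : T1 -> Z) (k2 : T2 -> Z) w1 w2 :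
    (forall t, wocc t w1 = 1%N) -> (forall t, wocc t w2 = 1%N) ->
    [/\ relabel (sum_fun k1 k2) (relabel inl w1) = relabel k1 w1,
       relabel (sum_fun k1 k2) (relabel inr w2) = relabel k2 w2 &
       forall t, (wocc t (relabel (@inl T1 T2) w1) +
                  wocc t (relabel (@inr T1 T2) w2) = 1)%N].
  move=> w1_1 w2_1; split; try by rewrite relabel_comp.
  case=> t; rewrite wocc_relabel ?w1_1 ?w2_1; try by move=> ? ? [].
    by rewrite wocc_relabel0.
  by rewrite wocc_relabel0.
elim/word_ind: w => [|z w [T [k [w' [kw w1]]]]|v w [T1 [k1 [v' [kv v1]]]] [T2 [k2 [w' [kw w1]]]]].
- by exists void, (@of_void Z), [::]; split=> // -[].
- have u1 : forall t : unit, wocc t [:: Var t] = 1%N by case.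
  have [e1 e2 c] := step unit T (fun=> z) k [:: Var tt] w' (fun 'tt => u1 tt) w1.
  exists (unit + T)%type, (sum_fun (fun=> z) k), (relabel inl [:: Var tt] ++ relabel inr w'); split.
    by rewrite relabel_cat e1 e2 kw.
  by move=> t; rewrite wocc_cat c.
have [e1 e2 c] := step T1 T2 k1 k2 v' w' v1 w1.
exists (T1 + T2)%type, (sum_fun k1 k2), (Brk (relabel inl v') :: relabel inr w'); split.
  by rewrite relabel_brk e1 e2 kv kw.
by move=> t; rewrite wocc_brk c.
Qed.

(** Each letter of Z in the words h x, for x in vs, receives a label of its own;
    k recovers the letter from the label. *)
Lemma label_words (X Z : choiceType) (vs : seq X) (h : X -> opmonom Z) :
  uniq vs ->
  exists (T : finType) (k : T -> Z) (h' : X -> opmonom T),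
    (forall x, x \in vs -> relabel k (h' x) = h x) /\
    forall t, (\sum_(x <- vs) wocc t (h' x) = 1)%N.
Proof.
elim: vs => [|x vs IH] /=.
  by exists void, (@of_void Z), (fun=> mone); split=> // -[].
case/andP=> x_vs /IH[T [k [h' [kh h1]]]].
have [T0 [k0 [w [kw w1]]]] := label_word (h x).
exists (T0 + T)%type, (sum_fun k0 k).
exists (fun y => if y == x then FMonom (relabel inl w)
                 else FMonom (relabel inr (h' y))); split=> [y|t].
  rewrite inE; case: eqP => [-> _|_ /= y_vs].
    by rewrite /= relabel_comp -kw.
  by rewrite /= relabel_comp -kh.
have eqs : \sum_(y <- vs) wocc t (if y == x then FMonom (relabel inl w)
             else FMonom (relabel (@inr T0 T) (h' y))) =
           \sum_(y <- vs) wocc t (relabel (@inr T0 T) (h' y)).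
  by apply: eq_big_seq => y y_vs; case: eqP => // e; rewrite -e y_vs in x_vs.
rewrite big_cons eqxx eqs /=.
case: t {eqs} => t.
  rewrite wocc_relabel ?w1 => [|? ? [] //].
  by rewrite big1 ?addn0 // => y _; rewrite wocc_relabel0.
rewrite wocc_relabel0 // add0n -[RHS](h1 t); apply: eq_bigr => y _.
by rewrite wocc_relabel // => ? ? [].
Qed.

(** The labels of w1 are pairwise distinct, so the positionwise correspondence
    between w1 and w2 is a function of the labels of w1. *)
Lemma same_shape_relabel (T : finType) (Z : choiceType) (k : T -> Z) w1 w2 :
  relabel k w1 = relabel k w2 -> (forall t, (wocc t w1 <= 1)%N) ->
  exists s : T -> T, relabel s w1 = w2.
Proof.
elim/word_ind: w1 w2 => [|t w IH|v w IHv IHw] w2.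
- by move/esym/relabel_eq0 => -> _; exists id.
- case: w2 => [|[t2|v2] w2] //; rewrite !relabelE => -[ek e] lin.
  have [|s <-] := IH _ e.
    by move=> x; apply: leq_trans (lin x); rewrite wocc_var leq_addl.
  exists (fun x => if x == t then t2 else s x); rewrite relabelE eqxx.
  congr (_ :: _); apply: eq_relabel => x xw; case: eqP => // e'.
  by have := lin t; rewrite wocc_var eqxx -e' add1n ltnS leqn0 eqn0Ngt xw.
case: w2 => [|[t2|v2] w2] //; rewrite !relabelE => -[ev ew] lin.
have [|sv <-] := IHv _ ev.
  by move=> x; apply: leq_trans (lin x); rewrite wocc_brk leq_addr.
have [|sw <-] := IHw _ ew.
  by move=> x; apply: leq_trans (lin x); rewrite wocc_brk leq_addl.
exists (fun x => if (0 < wocc x v)%N then sv x else sw x); rewrite relabelE.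
congr (Brk _ :: _); apply: eq_relabel => x xw; first by rewrite xw.
case: ifP => // xv; have := lin x; rewrite wocc_brk leqNgt.
by rewrite -(prednK xv) -(prednK xw) addSn addnS.
Qed.

Lemma surj_inj (T : finType) (s : T -> T) :
  (forall y, exists x, s x = y) -> injective s.
Proof.
move=> surj.
have sK (y : T) : exists x, s x == y by have [x <-] := surj y; exists x.
pose g y := xchoose (sK y).
have gK : cancel g s by move=> y; apply/eqP/(xchooseP (sK y)).
exact: bij_inj (bij_can_bij (injF_bij (can_inj gK)) gK).
Qed.

Section Code.
Context {T : finType} {Z : choiceType} (z0 : Z).

(** Labels become elements of the free operated monoid on Z: the k-th label is
    the bracketed power of z0 with exponent k + 1. The coded words contain
    z0 inside such brackets only, and the exponent is positive, so codes cannot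
    be confused with the brackets of the labelled word. *)
Definition code (t : T) : opmonom Z :=
  FMonom [:: Brk (nseq (enum_rank t).+1 (Var z0))].

Lemma sub_code_inj : injective (sub code).
Proof.
move=> w1 w2; elim/word_ind: w1 w2 => [|t w IH|v w IHv IHw] [|[t2|v2] w2] //.
- rewrite !sub_var /= => -[/(congr1 size)]; rewrite !size_nseq => er ew.
  by rewrite (IH _ ew); congr (Var _ :: _); apply: enum_rank_inj; apply: val_inj.
- by rewrite sub_var sub_brk /= => -[]; case: v2 => [|[]].
- by rewrite sub_var sub_brk /= => -[]; case: v IHv => [|[? ?|? ?]].
by rewrite !sub_brk => -[/IHv -> /IHw ->].
Qed.

End Code.

(** * Words over Z inside values of words without adjacent variables *)

Definition update (X Z : choiceType) (h : X -> opmonom Z) x v : X -> opmonom Z :=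
  fun y => if y == x then v else h y.

Definition no_adjacent_vars (X : choiceType) (w : seq (letter X)) : Prop :=
  forall c x y, w <> fill c [:: Var x; Var y].

Section Factors.
Context {X Z : choiceType}.
Implicit Types (h : X -> opmonom Z) (w : seq (letter X)).

Lemma sub_split h w a t b : sub h w = a ++ t :: b ->
  exists w1 s w2 a' b', [/\ w = w1 ++ s :: w2, letter_subst h s = a' ++ t :: b',
    a = sub h w1 ++ a' & b = b' ++ sub h w2].
Proof.
elim: w a => [|s w IH] a; first by case: a.
have -> : sub h (s :: w) = letter_subst h s ++ sub h w by [].
have [sz e|sz /esym e] := leqP (size (letter_subst h s)) (size a).
  have [a' -> /IH[w1 [r [w2 [a2 [b2 [-> rE -> ->]]]]]]] := cat_eq_le e sz.
  exists (s :: w1), r, w2, a2, b2; split=> //.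
  by rewrite catA.
have [[|t' v] sE] := cat_eq_le e (ltnW sz).
  by move: sz; rewrite sE cats0 ltnn.
case=> et eb; subst t' b; exists [::], s, w, a, v; split=> //.
Qed.

Lemma sub_update h w x v : wocc x w = 0%N -> sub (update h x v) w = sub h w.
Proof.
by move=> w0; apply: eq_sub_occ => y yw; rewrite /update; case: eqP => // e; rewrite e w0 in yw.
Qed.

(** The letters of a nonempty factor over Z come from values of variables. If
    the factor left the value in which it starts, the next letter of w would be
    a variable adjacent to x or a bracket. The last conclusion says that the
    context c is w with c' put at x; it uses that x occurs once. *)
Lemma factor_in_variable h w c (l : seq Z) :
  no_adjacent_vars w -> (forall y, (wocc y w <= 1)%N) -> l != [::] ->
  sub h w = fill c (vars l) ->
  exists x c', [/\ (0 < wocc x w)%N, h x = plugc c' (word l) &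
    forall u : opmonom Z, sub (update h x (plugc c' u)) w = fill c u].
Proof.
move=> na lin l0; elim: c w na lin => [a b|a c IH b] w na lin /=.
  case: l l0 => // z l _ /= /sub_split[w1 [[x|v] [w2 [a' [b' [wE xE aE bE]]]]]]; last first.
    by case: a' xE aE => [|? []].
  have [] : wocc x w1 = 0%N /\ wocc x w2 = 0%N.
    by have := lin x; rewrite wE wocc_cat wocc_var eqxx addnCA add1n ltnS leqn0
      addn_eq0 => /andP[/eqP ? /eqP ?].
  have [sz|sz] := leqP (size (vars l)) (size b') => x1 x2.
    have [b'' b'E b''E] := cat_eq_le bE sz.
    exists x, (Hole a' b''); split=> [||u].
    - by rewrite wE wocc_cat wocc_var eqxx addnCA.
    - rewrite -[RHS]/(FMonom (a' ++ Var z :: (vars l ++ b''))) -b'E -xE.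
      exact/esym/fmK.
    rewrite wE sub_cat sub_var !sub_update // /update eqxx /= aE b''E.
    by rewrite -!catA.
  have [o lE o_w2] := cat_eq_le (esym bE) (ltnW sz).
  have [l1 [[|z' l2] [_ _ oE]]] := map_eq_cat lE.
    by move: sz; rewrite lE oE cats0 ltnn.
  move: o_w2; rewrite oE; case: w2 wE {bE x2} => [|[x2|v] w2] wE //= _.
  by case: (na (Hole w1 w2) x x2); rewrite wE.
case/sub_split=> [w1 [[x|v] [w2 [a' [b' [wE xE aE bE]]]]]].
  have [x1 x2] : wocc x w1 = 0%N /\ wocc x w2 = 0%N.
    by have := lin x; rewrite wE wocc_cat wocc_var eqxx addnCA add1n ltnS leqn0
      addn_eq0 => /andP[/eqP ? /eqP ?].
  exists x, (Nest a' c b'); split=> [||u].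
  - by rewrite wE wocc_cat wocc_var eqxx addnCA.
  - by rewrite /plugc /= -xE; apply/esym/fmK.
  rewrite wE sub_cat sub_var !sub_update // /update eqxx /= aE bE.
  by rewrite -!catA.
case: a' xE aE => [|? [|? ?]] //= -[vE b'E] aE; subst b'.
have [||x [c' [xv hx cE]]] := IH v _ _ vE.
- by move=> d x y vE'; apply: (na (Nest w1 d w2) x y); rewrite wE vE'.
- by move=> y; apply: leq_trans (lin y); rewrite wE wocc_cat wocc_brk addnCA leq_addr.
have [x1 x2] : wocc x w1 = 0%N /\ wocc x w2 = 0%N.
  have := lin x; rewrite wE wocc_cat wocc_brk addnCA -(prednK xv) addSn ltnS.
  by rewrite leqn0 !addn_eq0 => /andP[_ /andP[/eqP ? /eqP ?]].
exists x, c'; split=> // [|u].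
  by rewrite wE wocc_cat wocc_brk addnCA addn_gt0 xv.
by rewrite wE sub_cat sub_brk cE !sub_update // aE bE cats0.
Qed.

(** The last letter of w is not a bracket, and its value is not empty: otherwise
    the value of w would end with the bracket that precedes this variable. *)
Lemma last_factor h w a z : no_adjacent_vars w ->
  sub h w = a ++ [:: Var z] -> exists w1 x b,
    w = w1 ++ [:: Var x] /\ h x = FMonom (b ++ [:: Var z]).
Proof.
move=> na /sub_split[w1 [[x|v] [w2 [a' [b' [wE xE _]]]]]]; last first.
  by case: a' xE => [|? []].
case: b' xE => // xE /esym w2E.
case: w2 wE w2E => [|[y|v] w2] wE // _; last by case: (na (Hole w1 w2) x y).
by exists w1, x, a'; split=> //; rewrite -xE; apply/esym/fmK.
Qed.

(** The mirror image of last_factor. *)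
Lemma first_factor h w b z : no_adjacent_vars w ->
  sub h w = Var z :: b -> exists w2 x b',
    w = Var x :: w2 /\ h x = FMonom (Var z :: b').
Proof.
move=> na /(@sub_split _ _ [::])[w1 [[x|v] [w2 [a' [b' [wE xE aE _]]]]]]; last first.
  by case: a' xE {aE} => [|? []].
have [w1E a'E] : sub h w1 = [::] /\ a' = [::] by case: (sub h w1) aE => // <-.
subst a'; rewrite /= in xE; case/lastP: w1 wE w1E {aE} => [|w1 [y|v]] wE.
- by move=> _; exists w2, x, b'; split=> //; rewrite -xE; apply/esym/fmK.
- by case: (na (Hole w1 w2) y x); rewrite wE -cats1 -!catA.
by rewrite -cats1 sub_cat; case: (sub h w1).
Qed.

Lemma single_var h w c (l : seq Z) : no_adjacent_vars w -> w <> [::] ->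
  vars l = fill c (sub h w) -> exists x, w = [:: Var x].
Proof.
move=> na w0; case: c => [a b|a c b] /= /map_eq_cat[l1 [l2 [_ _]]]; last first.
  by case: l2.
move=> /esym/map_eq_cat[l3 [_ [_ wE _]]].
case: w na w0 wE => [|[x|v] [|[y|v'] w]] // na _; try by case: l3.
- by exists x.
- by case: (na (Hole [::] w) x y).
rewrite sub_var => /esym/map_eq_cat[_ [l4 [_ _]]].
by case: l4.
Qed.

End Factors.

Section Size.
Context {Z : choiceType}.
Implicit Types (v w : seq (letter Z)) (c : context Z).

Fixpoint letter_size (a : letter Z) : nat :=
  if a is Brk w then (sumn (map letter_size w)).+1 else 1%N.

Definition word_size w : nat := sumn (map letter_size w).

Lemma word_size_cat v w : word_size (v ++ w) = (word_size v + word_size w)%N.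
Proof. by rewrite /word_size map_cat sumn_cat. Qed.

Lemma word_size_eq0 w : word_size w = 0%N -> w = [::].
Proof. by case: w => [|[]]. Qed.

(** Plugging adds the size of the context, brackets included. *)
Lemma fill_fixed c v : fill c v = v -> c = Hole [::] [::].
Proof.
suff [n nE n0] : exists2 n, forall v, word_size (fill c v) = (n + word_size v)%N
    & n = 0%N -> c = Hole [::] [::].
  move=> /(congr1 word_size); rewrite nE => /eqP.
  by rewrite -{2}[word_size v]add0n eqn_add2r => /eqP.
elim: c => [a b|a c [n nE _] b] /=.
  exists (word_size a + word_size b)%N => [u|/eqP].
    by rewrite !word_size_cat addnCA addnC.
  by rewrite addn_eq0 => /andP[/eqP/word_size_eq0 -> /eqP/word_size_eq0 ->].
exists (word_size a + (n + word_size b).+1)%N => [u|]; last by rewrite addnS.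
rewrite word_size_cat -[word_size (_ :: _)]/((word_size (fill c u)).+1 + word_size b)%N.
by rewrite nE -addnA; congr (_ + _)%N; rewrite !addSn addnAC.
Qed.

End Size.

Section Reduce.
Context (K : fieldType) (Z : choiceType) (le : rel (opmonom Z)).
Context (le_order : monomial_order (@plugc Z) le).
Context (S eG : {malg K[opmonom Z]} -> Prop).
Context (eG_amb : ambiguities_trivial (@plugc Z) le eG).
Local Notation lt := (lt_of le).
Local Notation comb := (comb (@plugc Z) le).
Local Notation lin := (plug_lin (@plugc Z)).
Local Notation all := (fun _ => True).
Let wo := le_order.1.
Implicit Types (f p r t : {malg K[opmonom Z]}).

Definition union f := S f \/ eG f.

Lemma comb_unionr P f : comb eG P f -> comb union P f.
Proof. by apply: comb_sub => // s; right. Qed.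

Lemma lin_id f : lin (Hole [::] [::]) f = f.
Proof.
rewrite [RHS]malg_sumE; apply: etrans (lin_extE _ _) _.
by apply: eq_bigr => -[m] _; rewrite /plugc /= cats0.
Qed.

Lemma comb_member G (P : opmonom Z -> Prop) f : G f -> P (lead le f) -> comb G P f.
Proof.
move=> Gf Pf; rewrite -(lin_id f); apply: comb_gen => //.
by rewrite /plugc /= cats0 fmK.
Qed.

(** The argument for inclusions in an instance f, with p = Psi(s),
    r = Psi(s - lead s), and t the multiple of s that is subtracted. The element
    k p - t lies in the span of multiples of G, and it is below w, because
    k f - t and r are. *)
Lemma comb_reduce f p r t k w : f = p - r -> comb eG all p ->
  comb union (fun m => lt m w) r -> comb eG all t ->
  (forall m, m \in msupp (k *: f) -> le m w) ->
  (forall m, m \in msupp t -> le m w) -> (k *: f)@_w = t@_w ->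
  comb union (fun m => lt m w) (k *: f - t).
Proof.
move=> fE cp cr ct fw tw ft.
have E : k *: f - t = (k *: p - t) - k *: r by rewrite fE scalerBr addrAC.
have lkp : lower le w (k *: p - t).
  rewrite -[_ - t](subrK (k *: r)) -E; apply: lowerD.
    exact: lower_cancel.
  exact/lowerZ/(comb_lower le_order cr).
rewrite E; apply: combB; last exact: combZ.
apply: comb_unionr; apply: composition_diamond => //.
by apply: combB => //; apply: combZ.
Qed.

End Reduce.

(** * The leading monomial of an instance of an identity *)

Section Generic.
Context (K : fieldType) (X Z : choiceType) (le : rel (opmonom Z)).
Context (le_order : monomial_order (@plugc Z) le).
Let wo := le_order.1.
Context (phi : {malg K[opmonom X]}) (L : opmonom X) (vs : seq X).
Context (L_phi : L \in msupp phi) (vs_uniq : uniq vs).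
Context (phi_occ : forall m y, m \in msupp phi -> wocc y m = (y \in vs)).

Definition ev (Y : choiceType) (h : X -> opmonom Y) : {malg K[opmonom Y]} :=
  lin_ext (subst h) phi.

Context (lead_ev : forall h : X -> opmonom Z,
  ev h = 0 \/ lead le (ev h) = subst h L).

Lemma ev_comp (Y T : choiceType) (g : Y -> opmonom T) (h : X -> opmonom Y) :
  lin_ext (subst g) (ev h) = ev (fun x => subst g (h x)).
Proof.
by rewrite /ev lin_ext_comp; apply: eq_lin_ext => m _ /=; rewrite subst_comp.
Qed.

Lemma eq_subst_vs (Y : choiceType) (g h : X -> opmonom Y) m :
  (forall x, x \in vs -> g x = h x) -> m \in msupp phi -> subst g m = subst h m.
Proof.
move=> gh mphi; rewrite !substE; congr FMonom; apply: eq_sub_occ => x xm.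
by apply: gh; move: xm; rewrite phi_occ //; case: (x \in vs).
Qed.

Lemma eq_ev (Y : choiceType) (g h : X -> opmonom Y) :
  (forall x, x \in vs -> g x = h x) -> ev g = ev h.
Proof. by move=> gh; apply: eq_lin_ext => m; apply: eq_subst_vs. Qed.

Lemma wocc_subst (Y : choiceType) (h : X -> opmonom Y) m y : m \in msupp phi ->
  wocc y (subst h m) = (\sum_(x <- vs) wocc y (h x))%N.
Proof.
move=> mphi; rewrite (wocc_sub _ _ vs_uniq) => [|x]; last first.
  by rewrite phi_occ //; case: (x \in vs).
by apply: eq_big_seq => x x_vs; rewrite phi_occ // x_vs mul1n.
Qed.

Section Labelled.
Context (z0 : Z) (T : finType) (h : X -> opmonom T).
Context (h_label : forall t, (\sum_(x <- vs) wocc t (h x) = 1)%N).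

(** The key lemma. Any w of the shape of the leading word w1 is s w1 for a
    permutation s of the labels. Coding the labels after permuting them by p
    yields an instance over Z, whose leading monomial is the code of p w1; so
    the code of p (s w1) is at most the code of p w1, for every p. At a p for
    which the latter is minimal both are equal. *)
Lemma labelled_shape (k : T -> Z) (w : opmonom T) : w \in msupp (ev h) ->
  relabel k w = relabel k (subst h L) -> w = subst h L.
Proof.
move=> w_in ek; set w1 := subst h L in ek *.
have w1_occ t : wocc t w1 = 1%N by rewrite wocc_subst.
have w_occ t : wocc t w = 1%N.
  by have [m mphi ->] := msupp_lin_ext w_in; rewrite wocc_subst.
have [|s sw] := same_shape_relabel (esym ek); first by move=> t; rewrite w1_occ.
have s_inj : injective s.
  by apply: surj_inj => t; apply: (@wocc_relabel_codom _ _ _ _ w1); rewrite sw w_occ.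
pose img (p : {perm T}) (v : opmonom T) : opmonom Z :=
  FMonom (sub (code z0) (relabel p v)).
have imgE p v : img p v = subst (code z0) (subst (fun t => mvar (p t)) v) by [].
have img_inj p : injective (img p).
  move=> [u] [v] [/sub_code_inj e]; congr FMonom.
  have := congr1 (relabel (p^-1)%g) e; rewrite !relabel_comp.
  have id_p (x : seq (letter T)) : relabel ((p^-1)%g \o p) x = x.
    by rewrite -[RHS]sub_mvar; apply: eq_sub => t /=; rewrite permK.
  by rewrite !id_p.
have img_le p : le (img p w) (img p w1).
  pose hp x := subst (code z0) (subst (fun t => mvar (p t)) (h x)).
  have evE : ev hp = lin_ext (img p) (ev h).
    by rewrite /hp -ev_comp -ev_comp lin_ext_comp.
  have w_hp : img p w \in msupp (ev hp).
    by rewrite -mcoeff_neq0 evE coef_lin_ext_inj // mcoeff_neq0.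
  have -> : img p w1 = lead le (ev hp).
    case: (lead_ev hp) => [e|->]; first by rewrite e msupp0 in w_hp.
    by rewrite /hp -subst_comp -subst_comp.
  exact: le_lead.
have [|a [[]]] := wo (A := [pred a | [exists p : {perm T}, a == img p w1]]).
  by exists (img 1%g w1); rewrite inE; apply/existsP; exists 1%g.
rewrite inE => /existsP[p /eqP ->] lb _.
have img_s : img p w = img (perm s_inj * p)%g w1.
  rewrite /img -sw relabel_comp; congr (FMonom (sub _ _)).
  by apply: eq_relabel => t _; rewrite /= permM permE.
apply: (img_inj p); apply: (wo_anti wo); first exact: img_le.
by apply: lb; rewrite inE img_s; apply/existsP; exists (perm s_inj * p)%g.
Qed.

(** Words of the labelled instance that become equal to the leading word when
    the labels are removed have its shape. *)
Lemma coef_lead_labelled (k : T -> Z) (g : X -> opmonom Z) :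
  (forall x, x \in vs -> relabel k (h x) = g x) ->
  (ev g)@_(subst g L) = (ev h)@_(subst h L).
Proof.
move=> kg.
have kg' x : x \in vs -> subst (fun t => mvar (k t)) (h x) = g x.
  by move=> /kg e; apply: val_inj.
rewrite -(eq_ev kg') -(eq_subst_vs kg') // -ev_comp -subst_comp.
by apply: coef_lin_ext_at => w w_in [e]; apply: (labelled_shape (k := k)).
Qed.

End Labelled.

(** Inserting words over Z next to a letter z of a value. With h labelling g,
    the labelling h' of the new values arises from h by the substitution d that
    puts freshly labelled words around the label t0 of z. The substitution e
    that erases the fresh labels is a left inverse of d, so the leading word has
    the same coefficient in both labelled instances. *)
Lemma ev_extend_neq0 (g : X -> opmonom Z) x0 a b z (l l' : seq Z) :
  x0 \in vs -> g x0 = FMonom (a ++ Var z :: b) -> ev g != 0 ->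
  ev (fun x => if x == x0 then FMonom (a ++ (vars l ++ Var z :: vars l') ++ b)
            else g x) != 0.
Proof.
move=> x0_vs gx0 g0; set g' := fun x => _.
have [T [k [h [kh h1]]]] := label_words g vs_uniq.
have := kh _ x0_vs; rewrite gx0.
move=> /relabel_split[a1 [l1 [hx0 ea el]]].
have [t0 [b1 [l1E ez eb]]] : exists t0 b1,
    [/\ l1 = Var t0 :: b1, k t0 = z & relabel k b1 = b].
  by move: el; clear; case: l1 => [|[t0|v] b1] //; rewrite relabelE => -[]; exists t0, b1.
have [Ts [ks [w [kw w1]]]] := label_word (vars l ++ vars l').
have [s1 [s2 [ws es1 es2]]] := relabel_split kw.
pose d t : opmonom (T + Ts)%type := if t == t0
  then FMonom (relabel inr s1 ++ Var (inl t0) :: relabel inr s2)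
  else mvar (inl t).
pose h' x := subst d (h x).
have h'1 (t : (T + Ts)%type) : (\sum_(x <- vs) wocc t (h' x) = 1)%N.
  have vsE x : wocc t (h' x) = (\sum_(u : T) wocc u (h x) * wocc t (d u))%N.
    rewrite /h' (wocc_sub d t (index_enum_uniq T)) // => u _.
    exact: mem_index_enum.
  rewrite (eq_bigr _ (fun x _ => vsE x)) exchange_big /=.
  under eq_bigr do rewrite -big_distrl /= h1 mul1n.
  rewrite (bigD1 t0) //= {1}/d eqxx wocc_cat wocc_var.
  have rest u : u != t0 -> wocc t (d u) = (inl u == t).
    by rewrite /d => /negbTE ->; rewrite wocc_var wocc0 addn0.
  rewrite (eq_bigr _ rest).
  case: t {vsE rest} => t; last first.
    rewrite !wocc_relabel => [|? ? [] //|? ? [] //].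
    rewrite big1 ?addn0 // addnC -addnA add0n addnC -wocc_cat -ws.
    exact: w1.
  rewrite !wocc_relabel0 // addn0 add0n.
  have inlE (u : T) : (inl u == inl t :> T + Ts) = (u == t) by [].
  under eq_bigr do rewrite inlE.
  rewrite inlE; have [->|ne] := eqVneq t0 t.
    by rewrite big1 // => u /negbTE ->.
  by rewrite (bigD1 t) 1?eq_sym //= eqxx big1 // => u /andP[_ /negbTE ->].
pose k' := sum_fun k ks.
have k'd (u : seq (letter T)) : wocc t0 u = 0%N ->
    relabel k' (sub d u) = relabel k u.
  move=> u0; rewrite /relabel sub_comp; apply: eq_sub_occ => t tu.
  by rewrite /d; case: eqP => // e; rewrite e u0 in tu.
have t0_occ x : x \in vs -> wocc t0 (h x) = (x == x0) :> nat.
  move=> x_vs; have := h1 t0; rewrite (bigD1_seq x0) //= hx0 l1E wocc_cat wocc_var eqxx.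
  rewrite addnCA add1n addSn => -[/eqP]; rewrite addn_eq0 => /andP[/eqP occ0 sum0].
  have [->|ne] := eqVneq x x0.
    by rewrite hx0 l1E wocc_cat wocc_var eqxx addnCA occ0.
  move: sum0; rewrite sum_nat_seq_eq0 => /allP/(_ x x_vs)/implyP/(_ ne)/eqP ->.
  by [].
have ab0 : wocc t0 a1 = 0%N /\ wocc t0 b1 = 0%N.
  have := t0_occ _ x0_vs; rewrite hx0 l1E wocc_cat wocc_var !eqxx addnCA.
  by rewrite add1n => -[/eqP]; rewrite addn_eq0 => /andP[/eqP ? /eqP ?].
have h'E x : fmonom_val (h' x) = sub d (h x) by [].
have k'h' x : x \in vs -> relabel k' (h' x) = g' x.
  rewrite /g' => x_vs; have := t0_occ x x_vs; case: eqP => [-> _|_ x0'].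
    rewrite h'E hx0 l1E sub_cat sub_var !relabel_cat !k'd; try by case: ab0.
    rewrite ea eb /d eqxx /= relabel_cat relabel_var !relabel_comp /= ez.
    by rewrite -es1 -es2 -!catA.
  by rewrite h'E k'd // kh.
pose e (t : (T + Ts)%type) : opmonom T := if t is inl t' then mvar t' else FMonom [::].
have erase l0 (v : seq (letter Ts)) : relabel ks v = vars l0 ->
    sub e (relabel inr v) = [::].
  elim: v l0 => [|[u|v'] v IH] // [|y l0] //; rewrite !relabelE => -[] // _.
  by rewrite sub_var; apply: IH.
have ed : cancel (subst d) (subst e).
  move=> [u]; rewrite subst_comp substE; congr FMonom.
  rewrite -[RHS]sub_mvar; apply: eq_sub => t.
  rewrite /d; case: eqP => [->|] //.
  by rewrite substE /= sub_cat sub_var /= (erase _ _ es1) (erase _ _ es2).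
have c1 := coef_lead_labelled z h1 kh.
have c2 := coef_lead_labelled z h'1 k'h'.
have evh' : ev h' = lin_ext (subst d) (ev h) by rewrite ev_comp.
have := c2; rewrite evh' -[subst h' L]subst_comp (coef_lin_ext_inj _ _ (can_inj ed)).
rewrite -c1 => c3; apply/eqP => g'0.
move: c3; rewrite g'0 mcoeff0; case: (lead_ev g) => [/eqP|<-]; first by rewrite (negbTE g0).
by move/eqP; rewrite eq_sym (negbTE (lead_cf_neq0 wo g0)).
Qed.

Section Compositions.
Context (S eG : {malg K[opmonom Z]} -> Prop) (S_ev : forall h, S (ev h)).
Context (eG_amb : ambiguities_trivial (@plugc Z) le eG).
Context (na : no_adjacent_vars L).
Local Notation lt := (lt_of le).
Local Notation comb := (comb (@plugc Z) le).
Local Notation lin := (plug_lin (@plugc Z)).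
Local Notation union := (union S eG).

Lemma wocc_L y : (wocc y L <= 1)%N.
Proof. by rewrite phi_occ //; case: (y \in vs). Qed.

Lemma lead_ev_neq0 h : ev h != 0 -> lead le (ev h) = subst h L.
Proof. by case: (lead_ev h) => // ->; rewrite eqxx. Qed.

Lemma comb_ev h w : (ev h != 0 -> lt (subst h L) w) ->
  comb union (fun m => lt m w) (ev h).
Proof.
have [->|h0] := eqVneq (ev h) 0; first by move=> _; apply: comb0.
move=> /(_ isT) hw; apply: comb_member; first by left.
by rewrite lead_ev_neq0.
Qed.

(** Here t is a monic element of G with leading monomial l, and k makes the
    instance monic. The map Psi sends t to the combination of the instances
    with c'[u] put at x, for the monomials u of t. *)
Lemma comb_inclusion h c l t k :
  l != [::] -> subst h L = plugc c (word l) ->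
  (forall d, comb eG (fun _ => True) (lin d t)) ->
  (forall m, m \in msupp t -> le m (word l)) -> t@_(word l) = 1 ->
  (forall m, m \in msupp (lin c t) -> le m (subst h L)) ->
  (lin c t)@_(subst h L) = 1 ->
  (forall m, m \in msupp (k *: ev h) -> le m (subst h L)) ->
  (k *: ev h)@_(subst h L) = 1 ->
  comb union (fun m => lt m (subst h L)) (k *: ev h - lin c t).
Proof.
move=> l0 hL ct t_le t1 ctw ct1 fw f1.
have [x [d [xL hx hu]]] := factor_in_variable na wocc_L l0 (congr1 val hL).
have x_vs : x \in vs by move: xL; rewrite phi_occ //; case: (x \in vs).
pose F (m : opmonom X) (u : opmonom Z) := subst (update h x (plugc d u)) m.
pose Psi p := \sum_(m <- msupp phi) phi@_m *: lin_ext (F m) p.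
have PsiE p : Psi p = \sum_(u <- msupp p) p@_u *: ev (update h x (plugc d u)).
  transitivity (\sum_(m <- msupp phi) \sum_(u <- msupp p)
      (phi@_m * p@_u) *: << F m u >> : {malg K[opmonom Z]}).
    apply: eq_bigr => m _; rewrite lin_extE scaler_sumr.
    by apply: eq_bigr => u _; rewrite scalerA.
  rewrite exchange_big; apply: eq_bigr => u _; rewrite /ev lin_extE scaler_sumr.
  by apply: eq_bigr => m _; rewrite scalerA mulrC.
have evE : ev h = ev (update h x (plugc d (word l))).
  by apply: eq_ev => y _; rewrite /update; case: eqP => // ->.
pose r := \sum_(u <- msupp t | u != word l) t@_u *: ev (update h x (plugc d u)).
have evPsi : ev h = Psi t - r.
  rewrite PsiE (bigD1_seq (word l)) ?fset_uniq //=.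
    by rewrite t1 scale1r -evE addrK.
  by rewrite -mcoeff_neq0 t1 oner_neq0.
have Psi_comb : comb eG (fun _ => True) (Psi t).
  apply: comb_sum => m mphi _; apply: combZ.
  have [e eE] :=
    context_of_occ h d (etrans (phi_occ x mphi) (congr1 nat_of_bool x_vs)).
  have -> : lin_ext (F m) t = lin e t.
    by apply: eq_lin_ext => u _; apply: val_inj; apply: eE.
  exact: ct.
have r_comb : comb union (fun m => lt m (subst h L)) r.
  apply: comb_sum => u ut ul; apply: combZ; apply: comb_ev => _.
  have -> : subst (update h x (plugc d u)) L = plugc c u.
    by apply: val_inj; apply: hu.
  rewrite hL; apply: le_order.2; apply: wo_le_neq_lt; first exact: t_le.
  exact/eqP.
exact: (comb_reduce le_order eG_amb evPsi Psi_comb r_comb (ct c) fw ctw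
  (etrans f1 (esym ct1))).
Qed.

Lemma le_monicize (f : {malg K[opmonom Z]}) w : lead le f = w ->
  forall m, m \in msupp (monicize le f) -> le m w.
Proof. by move=> <- m /(le_lead wo); rewrite lead_monicize. Qed.

Lemma monicize_at (f : {malg K[opmonom Z]}) w : f != 0 -> lead le f = w ->
  (monicize le f)@_w = 1.
Proof. by move=> f0 <-; apply: monicize_lead. Qed.

Lemma le_lin_monicize c (f : {malg K[opmonom Z]}) w v : lead le f = w ->
  plugc c w = v -> forall m, m \in msupp (lin c (monicize le f)) -> le m v.
Proof. by move=> <- <-; apply: plug_lin_monic_le. Qed.

Lemma lin_monicize_at c (f : {malg K[opmonom Z]}) w v : f != 0 ->
  lead le f = w -> plugc c w = v -> (lin c (monicize le f))@_v = 1.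
Proof. by move=> f0 <- <-; apply: plug_lin_monic. Qed.

Lemma inclusion_in_instance h c l s : ev h != 0 -> eG s -> s != 0 ->
  lead le s = word l -> subst h L = plugc c (word l) ->
  comb union (fun m => lt m (subst h L))
    (monicize le (ev h) - lin c (monicize le s)).
Proof.
move=> h0 Gs s0 sl hL.
have hf := lead_ev_neq0 h0.
have f_le := le_monicize hf; have f1 := monicize_at h0 hf.
have s_le := le_lin_monicize sl (esym hL).
have s1 := lin_monicize_at s0 sl (esym hL).
(* if lead s = 1, every monomial is a multiple of lead s *)
have [l0|l0] := eqVneq l [::].
  apply: (comb_all le_order) => [v _|].
    exists (Hole v [::]), s; split=> //; first by right.
    by rewrite sl l0 /plugc /= cats0 fmK.
  exact: (lower_cancel f_le s_le (etrans f1 (esym s1))).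
apply: (comb_inclusion l0 hL _ (le_monicize sl) (monicize_at s0 sl) s_le s1 f_le f1).
by move=> d; apply: comb_gen_monic.
Qed.

(** The instance at x = v has leading monomial v if it is not zero. It is not
    zero, because a word in which x occurs once takes the value v at x = v only
    if it is x itself, so the coefficient of v is the coefficient of x in
    phi. *)
Lemma single_var_all x w e : L = FMonom [:: Var x] -> lower le w e ->
  comb union (fun m => lt m w) e.
Proof.
move=> Lx; apply: (comb_all le_order) => v _.
have x_vs y : (y \in vs) = (y == x).
  have := phi_occ y L_phi; rewrite Lx wocc_var wocc0 addn0 eq_sym.
  by case: eqP; case: (y \in vs).
pose h := fun _ : X => v.
have hL : subst h L = v by rewrite Lx substE sub_var cats0 fmK.
have h0 : ev h != 0.
  have : (ev h)@_(subst h L) != 0.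
    rewrite coef_lin_ext_at ?mcoeff_neq0 // => m m_phi mL.
    have xm : wocc x m = 1%N by rewrite phi_occ // x_vs eqxx.
    have [c cE] := context_of_occ h (Hole [::] [::]) xm.
    have cv : fill c v = v.
      have e1 : sub h m = v := congr1 val (etrans mL hL).
      rewrite -cE -[RHS]e1; apply: eq_sub => y; case: eqP => // _.
      by rewrite /plugc /= cats0 fmK.
    have := cE (FMonom [::]); rewrite (fill_fixed cv) /=.
    have m_var y : (0 < wocc y m)%N -> y = x.
      by rewrite phi_occ // x_vs; case: eqP.
    rewrite Lx -(fmK m); move: (fmonom_val m) xm m_var => {m m_phi mL cE} [|[y|b] m] //.
    move=> xm m_var; have yx := m_var y; rewrite wocc_var eqxx in yx.
    have {}yx := yx isT; subst y.
    rewrite sub_var eqxx /=; case: m xm m_var => [|[y|b] m] // xm m_var.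
    have yx := m_var y; rewrite !wocc_var eqxx addnCA in yx.
    have {}yx := yx isT; subst y.
    by move: xm; rewrite !wocc_var !eqxx.
  by apply: contraNneq => ->; rewrite mcoeff0.
exists (Hole [::] [::]), (ev h); split=> //; first by left.
by rewrite lead_ev_neq0 // hL /plugc /= cats0 fmK.
Qed.

(** The value of the leading monomial is free of brackets, so this monomial is a
    product of variables, hence a single variable. *)
Lemma inclusion_of_instance h c l s : vs != [::] -> ev h != 0 -> eG s -> s != 0 ->
  lead le s = word l -> word l = plugc c (subst h L) ->
  comb union (fun m => lt m (word l))
    (monicize le s - lin c (monicize le (ev h))).
Proof.
move=> vs0 h0 Gs s0 sl lE.
have L0 : fmonom_val L <> [::].
  move=> L0; case: vs vs0 phi_occ => // x vs' _ /(_ L x L_phi).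
  by rewrite inE eqxx /wocc -[FMonom _]/(FMonom (fmonom_val L)) L0.
have [x Lx] := single_var na L0 (congr1 val lE).
apply: (@single_var_all x); first by rewrite -Lx fmK.
have hf := lead_ev_neq0 h0.
exact: (lower_cancel (le_monicize sl) (le_lin_monicize hf (esym lE))
  (etrans (monicize_at s0 sl) (esym (lin_monicize_at h0 hf (esym lE))))).
Qed.

Context (S_incl : forall f g c, S f -> S g -> f != 0 -> g != 0 ->
  lead le f = plugc c (lead le g) ->
  comb S (fun m => lt m (lead le f)) (monicize le f - lin c (monicize le g))).

(** An intersection of an instance and s, resolved through an instance at h'
    whose leading monomial is the common multiple w. *)
Lemma comb_via h h' c d l s w : ev h != 0 -> ev h' != 0 -> eG s -> s != 0 ->
  lead le s = word l -> subst h' L = w -> w = plugc c (subst h L) ->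
  w = plugc d (word l) ->
  comb union (fun m => lt m w)
    (lin c (monicize le (ev h)) - lin d (monicize le s)).
Proof.
move=> h0 h'0 Gs s0 sl h'w wc wd.
have c1 : comb union (fun m => lt m w) (monicize le (ev h') - lin d (monicize le s)).
  by rewrite -h'w; apply: (inclusion_in_instance (l := l)) => //; rewrite h'w.
have c2 : comb union (fun m => lt m w)
    (monicize le (ev h') - lin c (monicize le (ev h))).
  have lh := lead_ev_neq0 h0; have lh' := etrans (lead_ev_neq0 h'0) h'w.
  have e : lead le (ev h') = plugc c (lead le (ev h)) by rewrite lh lh'.
  have := S_incl (S_ev h') (S_ev h) h'0 h0 e; rewrite lh'.
  by apply: comb_sub => // f; left.
have := combB c1 c2.
set A := monicize _ _; set B := lin _ _; set B' := lin _ _.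
by rewrite opprB addrC addrA subrK.
Qed.

(** The overlap ends the value of the last letter of the leading monomial, which
    is a variable; the instance through which the composition is resolved puts
    the value followed by u there. *)
Lemma intersection_right h l s (u v : seq (letter Z)) :
  ev h != 0 -> eG s -> s != 0 -> lead le s = word l ->
  subst h L ++ u = v ++ vars l -> (size u < size l)%N ->
  comb union (fun m => lt m (FMonom (subst h L ++ u)))
    (lin (Hole [::] u) (monicize le (ev h)) - lin (Hole v [::]) (monicize le s)).
Proof.
move=> h0 Gs s0 sl e ul.
have sz : (size v < size (subst h L))%N.
  have := congr1 size e; rewrite !size_cat size_map => es.
  by rewrite -(ltn_add2r (size u)) es ltn_add2l.
have [o FE oE] := cat_eq_le (esym e) (ltnW sz).
have [lo [lu [_ oE' uE]]] := map_eq_cat oE; subst o u.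
case/lastP: lo FE oE sz => [|lo z] FE oE; first by rewrite FE cats0 ltnn.
move=> _; have FE' : sub h L = (v ++ vars lo) ++ [:: Var z].
  by rewrite -[LHS]/(fmonom_val (subst h L)) FE map_rcons -cats1 catA.
have [w1 [x [b [LE hx]]]] := last_factor na FE'.
have x1 : wocc x w1 = 0%N.
  have := wocc_L x; rewrite -(fmK L) LE wocc_cat wocc_var eqxx.
  by rewrite wocc0 addn0 addn1 ltnS leqn0 => /eqP.
have x_vs : x \in vs.
  have := phi_occ x L_phi; rewrite -(fmK L) LE wocc_cat wocc_var eqxx.
  by case: (x \in vs) => //; rewrite addnC.
have h'0 := ev_extend_neq0 [::] lu x_vs hx h0.
rewrite /= in h'0; set h' := (X in ev X) in h'0.
have h'E : sub h' L = sub h L ++ vars lu.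
  have -> : h' = update h x (h' x) by rewrite /h' /update eqxx.
  rewrite LE !sub_cat !sub_var sub_update // /update /h' !eqxx hx !sub0 !cats0 /=.
  by rewrite -!catA.
apply: (comb_via h0 h'0 Gs s0 sl).
- by apply: val_inj; apply: h'E.
- by rewrite /plugc /=.
by rewrite /plugc /= cats0 e.
Qed.

Lemma intersection_left h l s (u v : seq (letter Z)) :
  ev h != 0 -> eG s -> s != 0 -> lead le s = word l ->
  vars l ++ u = v ++ subst h L -> (size v < size l)%N ->
  comb union (fun m => lt m (FMonom (v ++ subst h L)))
    (lin (Hole v [::]) (monicize le (ev h)) - lin (Hole [::] u) (monicize le s)).
Proof.
move=> h0 Gs s0 sl e vl.
have sz : (size v <= size (vars l))%N by rewrite size_map ltnW.
have [o lE FE] := cat_eq_le (esym e) sz.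
have [lv [lo [lE' vE oE]]] := map_eq_cat lE; subst v o.
case: lo FE lE lE' => [|z lo] FE lE lE'.
  by move: vl; rewrite lE' cats0 size_map ltnn.
have FE' : sub h L = Var z :: (vars lo ++ u) by rewrite -[LHS]/(fmonom_val (subst h L)) FE.
have [w2 [x [b [LE hx]]]] := first_factor na FE'.
have x2 : wocc x w2 = 0%N.
  have := wocc_L x; rewrite -(fmK L) LE wocc_var eqxx.
  by rewrite add1n ltnS leqn0 => /eqP.
have x_vs : x \in vs.
  have := phi_occ x L_phi; rewrite -(fmK L) LE wocc_var eqxx.
  by case: (x \in vs).
have h'0 := @ev_extend_neq0 h x [::] b z lv [::] x_vs hx h0.
rewrite /= in h'0; set h' := (X in ev X) in h'0.
have h'E : sub h' L = vars lv ++ sub h L.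
  have -> : h' = update h x (h' x) by rewrite /h' /update eqxx.
  rewrite LE !sub_var sub_update // /update /h' !eqxx hx /=.
  by rewrite -!catA.
apply: (comb_via h0 h'0 Gs s0 sl).
- by apply: val_inj; apply: h'E.
- by rewrite /plugc /= cats0.
by rewrite /plugc /= e.
Qed.

End Compositions.

End Generic.

(** * Compositions between instances and the basis of the free algebra *)

Lemma op_order_plugc (Z : choiceType) (le : rel (opmonom Z)) :
  op_monomial_order le -> monomial_order (@plugc Z) le.
Proof.
case=> wo mono; split=> // c u v /(mono (star_of c)).
by rewrite !op_plug_star_of.
Qed.

Section Conversion.
Context (K : fieldType) (Z : choiceType) (le : rel (opmonom Z)).
Local Notation lt := (lt_of le).
Local Notation comb := (comb (@plugc Z) le).
Local Notation lin := (plug_lin (@plugc Z)).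
Implicit Types (G : {malg K[opmonom Z]} -> Prop) (t : {malg K[opmonom Z]}).

Lemma op_GS_plugc G : is_op_GS le G -> is_GS (@fdeg _) (@plugc Z) le G.
Proof.
apply: is_GS_sub => [|c]; first exact: context_of_star.
by exists (star_of c) => u; rewrite op_plug_star_of.
Qed.

Lemma plugc_op_GS G : is_GS (@fdeg _) (@plugc Z) le G -> is_op_GS le G.
Proof.
apply: is_GS_sub => [c|q].
  by exists (star_of c) => u; rewrite op_plug_star_of.
by have [c cE] := context_of_star q; exists c => u; rewrite cE.
Qed.

Lemma mulgU_lin t (u : opmonom Z) : t * << u >> = lin (Hole [::] u) t.
Proof.
rewrite mulg_lin_ext; apply: eq_lin_ext => m _.
by rewrite fmonomM.
Qed.

Lemma mulUg_lin t (v : opmonom Z) : << v >> * t = lin (Hole v [::]) t.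
Proof.
rewrite mulUg_lin_ext; apply: eq_lin_ext => m _.
by rewrite fmonomM /plugc /= cats0.
Qed.

Lemma intersections_comb G t1 t2 (l1 l2 : opmonom Z) :
  lead le t1 = l1 -> lead le t2 = l2 ->
  (forall u v : opmonom Z, (l1 : seq _) ++ u = (v : seq _) ++ l2 ->
     (size u < size l2)%N -> (size v < size l1)%N ->
     comb G (fun m => lt m (FMonom (l1 ++ u)))
       (lin (Hole [::] u) t1 - lin (Hole v [::]) t2)) ->
  intersections_trivial (@fdeg _) (@plugc Z) le G t1 t2.
Proof.
move=> <- <- inter u v w wu wv; rewrite {1}wu {1}wv !fmonomM /fdeg !size_cat => szs.
apply/trivial_modP; rewrite mulgU_lin mulUg_lin {1}wu fmonomM.
move: wv; rewrite wu !fmonomM => -[e].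
case/andP: szs => _ vl; have es := congr1 size e; rewrite !size_cat in es.
apply: inter => //; last by rewrite -(ltn_add2r (size (lead le t2))).
by rewrite -(ltn_add2l (size (lead le t1))) es.
Qed.

Lemma inclusions_comb G t1 t2 (l1 l2 : opmonom Z) :
  lead le t1 = l1 -> lead le t2 = l2 ->
  (forall c, l1 = plugc c l2 -> comb G (fun m => lt m l1) (t1 - lin c t2)) ->
  inclusions_trivial (@plugc Z) le G t1 t2.
Proof.
move=> <- <- incl c w wE wc; apply/trivial_modP; rewrite wE.
by apply: incl; rewrite -wE.
Qed.

End Conversion.

Section Ideals.
Context (K : fieldType) (Z : choiceType).
Local Notation lin := (plug_lin (@plugc Z)).

Lemma emb_linU (c : K) (m : {fmonom Z}) :
  emb_lin (c *: << m >>) = c *: << emb m >>.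
Proof. by rewrite -!malgU_scale; apply: lin_extU. Qed.

Lemma emb_linM (f g : {malg K[{fmonom Z}]}) :
  emb_lin (f * g) = emb_lin f * emb_lin g.
Proof.
rewrite [f]malg_sumE mulr_suml !linear_sum mulr_suml; apply: eq_bigr => m _.
have e1 : emb_lin (f@_m *: << m >> * g) = f@_m *: emb_lin (<< m >> * g).
  by rewrite -scalerAl; apply: linearZ.
have e2 := etrans (emb_mull g m) (esym (mulUg_lin (emb_lin g) (emb m))).
apply: etrans e1 (etrans (congr1 (GRing.scale f@_m) e2) _).
apply: etrans (scalerAl _ _ _) _.
exact: (congr1 (fun t => t * emb_lin g) (esym (emb_linU f@_m m))).
Qed.

Lemma emb_preimage_ideal (I : {malg K[opmonom Z]} -> Prop) :
  is_ideal I -> is_ideal (fun g => I (emb_lin g)).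
Proof.
case=> I0 ID IM; split=> [|f g If Ig|a f b If].
- by rewrite linear0.
- exact: (eq_ind_r I (ID _ _ If Ig) (linearD (@emb_lin K Z) f g)).
by rewrite (emb_linM (a * f) b) (emb_linM a f); apply: IM.
Qed.

(** Generators of I_A may be replaced by G, since the elements of the free algebra
    whose images lie in an ideal form an ideal. *)
Lemma operated_ideal_gen_emb (S : {malg K[opmonom Z]} -> Prop)
    (G I_A : {malg K[{fmonom Z}]} -> Prop) :
  (forall g, I_A g <-> ideal_gen G g) -> forall f,
  operated_ideal_gen (@op_bracket K Z) (fun f => S f \/ emb_image I_A f) f <->
  operated_ideal_gen (@op_bracket K Z) (fun f => S f \/ emb_image G f) f.
Proof.
move=> IG f; split=> gen I I_ideal I_gen; apply: gen => // s.
  case=> [Ss|[g /IG g_gen ->]]; first by apply: I_gen; left.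
  apply: (g_gen (fun g => I (emb_lin g))).
    by apply: emb_preimage_ideal; case: I_ideal.
  by move=> h Gh; apply: I_gen; right; exists h.
case=> [Ss|[g Gg ->]]; first by apply: I_gen; left.
by apply: I_gen; right; exists g => //; apply/IG => J _; apply.
Qed.

End Ideals.

Section Instances.
Context (K : fieldType) (X Z : choiceType).
Context (le : rel (opmonom Z)) (leX : rel (opmonom X)).
Context (leX_order : op_monomial_order leX).
Context (Phi : {malg K[opmonom X]} -> Prop).
Context (lead_subword : forall phi, Phi phi ->
  forall v : {fmonom X}, (2 <= fdeg v)%N -> ~ subword (emb v) (lead leX phi)).
Context (lead_subst : forall phi n (x : n.-tuple X), Phi phi ->
  multilinear_opi x phi -> forall u : n.-tuple (opmonom Z),
    opi_eval x phi u = 0 \/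
    lead le (opi_eval x phi u) = mon_eval x (lead leX phi) u).

(** An instance of an identity in Phi with the consequences of the hypotheses on
    Phi: values are given by functions on all variables instead of tuples, and
    multilinearity is the list vs of variables, each occurring once in every
    monomial. *)
Variant instance (f : {malg K[opmonom Z]}) : Prop :=
  Instance (phi : {malg K[opmonom X]}) (L : opmonom X) (vs : seq X)
    (h : X -> opmonom Z) of L \in msupp phi & uniq vs &
    (forall m y, m \in msupp phi -> wocc y m = (y \in vs)) &
    (forall h' : X -> opmonom Z, ev phi h' = 0 \/ lead le (ev phi h') = subst h' L) &
    no_adjacent_vars L & vs != [::] & (forall h' : X -> opmonom Z, S_of Phi (ev phi h')) &
    f = ev phi h.

Lemma instance_S_of f : S_of Phi f -> f != 0 -> instance f.
Proof.
case=> phi [n [x [u [Phi_phi [[n0 xU x_supp] lin] ->]]]] f0.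
have phi0 : phi != 0.
  by apply: contraNneq f0 => ->; rewrite /opi_eval linear0.
have phi_occ m y : m \in msupp phi -> wocc y m = (y \in x).
  move=> m_phi; have [/tnthP[i ->]|] := boolP (y \in x).
    by rewrite /wocc fmK; apply: (lin i m m_phi).
  by apply: contraNeq; rewrite -lt0n /wocc fmK; apply: x_supp.
have assignE h y : y \in x -> assign x (map_tuple h x) y = h y.
  move=> y_x; rewrite /assign (nth_map y) ?index_mem //.
  by rewrite nth_index.
have evE h : ev phi h = opi_eval x phi (map_tuple h x).
  by apply: (eq_ev phi_occ) => y y_x; rewrite assignE.
have L_phi : lead leX phi \in msupp phi by apply: (lead_supp leX_order.1).
exists phi (lead leX phi) (tval x) (assign x u) => //.
- move=> h; rewrite evE.
  have -> : subst h (lead leX phi) = mon_eval x (lead leX phi) (map_tuple h x).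
    by apply: (eq_subst_vs phi_occ) L_phi => y y_x; rewrite assignE.
  exact: lead_subst.
- move=> c y z LE; apply: (lead_subword Phi_phi (v := FMonom [:: y; z])) => //.
  by exists (star_of c); rewrite op_plug_star_of /plugc -LE fmK.
- by rewrite -size_eq0 size_tuple -lt0n.
by move=> h; exists phi, n, x, (map_tuple h x); split=> //; rewrite evE.
Qed.

End Instances.

Section Main.
Context (K : fieldType) (Z : choiceType) (le : rel (opmonom Z)).
Context (le_order : monomial_order (@plugc Z) le).
Context (S : {malg K[opmonom Z]} -> Prop).
Context (S_GS : is_GS (@fdeg _) (@plugc Z) le S).
Context (G : {malg K[{fmonom Z}]} -> Prop).
Context (G_GS : is_GS (@fdeg _) (@mon_plug {fmonom Z}) (emb_le le) G).
Local Notation eG := (emb_image G).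
Local Notation lt := (lt_of le).
Local Notation comb := (comb (@plugc Z) le).
Local Notation lin := (plug_lin (@plugc Z)).
Let wo := le_order.1.
Let amb := emb_ambiguities le_order G_GS.

Lemma S_inclusion f g c : S f -> S g -> f != 0 -> g != 0 ->
  lead le f = plugc c (lead le g) ->
  comb S (fun m => lt m (lead le f)) (monicize le f - lin c (monicize le g)).
Proof.
move=> Sf Sg f0 g0 e; have [_ incl] := S_GS Sf Sg f0 g0.
have H := incl c (lead le f) (esym (lead_monicize wo f))
  (etrans e (congr1 (plugc c) (esym (lead_monicize wo g)))).
exact: (proj1 (trivial_modP _ _ _ _ _) H).
Qed.

Lemma lead_eG s : eG s -> s != 0 -> exists l, lead le s = word l.
Proof.
case=> g _ -> eg0; exists (Defs.lead (emb_le le) g : seq Z).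
by rewrite (lead_emb le_order) ?(emb_lin_neq0 eg0).
Qed.

Lemma compositions_GG s1 s2 : eG s1 -> eG s2 -> s1 != 0 -> s2 != 0 ->
  intersections_trivial (@fdeg _) (@plugc Z) le (union S eG)
    (monicize le s1) (monicize le s2) /\
  inclusions_trivial (@plugc Z) le (union S eG)
    (monicize le s1) (monicize le s2).
Proof.
move=> G1 G2 s1_0 s2_0; split.
  apply: (intersections_comb (lead_monicize wo s1) (lead_monicize wo s2)) => u v e _ _.
  apply: comb_unionr.
  have e' : plugc (Hole [::] u) (lead le s1) = plugc (Hole v [::]) (lead le s2).
    by rewrite /plugc /= cats0 e.
  exact: (amb G1 G2 s1_0 s2_0 e').
apply: (inclusions_comb (lead_monicize wo s1) (lead_monicize wo s2)) => c e.
apply: comb_unionr.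
have e' : plugc (Hole [::] [::]) (lead le s1) = plugc c (lead le s2).
  by rewrite -e /plugc /= cats0 fmK.
have := amb G1 G2 s1_0 s2_0 e'; rewrite lin_id.
by rewrite /plugc /= cats0 fmK.
Qed.

Lemma union_GS (X : choiceType) (Phi : {malg K[opmonom X]} -> Prop) :
  (forall f, S f -> f != 0 -> instance le Phi f) ->
  (forall f, S_of Phi f -> S f) ->
  is_GS (@fdeg _) (@plugc Z) le (union S eG).
Proof.
move=> S_inst sub_S f1 f2 [S1|G1] [S2|G2] f1_0 f2_0.
- have [inter incl] := S_GS S1 S2 f1_0 f2_0.
  have weaken w f : trivial_mod (@plugc Z) le S w f ->
      trivial_mod (@plugc Z) le (union S eG) w f.
    move=> /trivial_modP H; apply/trivial_modP; apply: comb_sub H => // s.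
    by left.
  split=> [u v w wu wv szw|c w wf wc]; apply: weaken; first exact: inter.
  exact: incl.
- have [phi L vs h L_phi vsU occ lead_ev na vs0 S_ev f1E] := S_inst _ S1 f1_0.
  have [l sl] := lead_eG G2 f2_0.
  subst f1; have hf := lead_ev_neq0 lead_ev f1_0.
  have S_ev' h' := sub_S _ (S_ev h').
  have l1E := etrans (lead_monicize wo (ev phi h)) hf.
  have l2E := etrans (lead_monicize wo f2) sl.
  split.
    apply: (intersections_comb l1E l2E) => u v e ul _.
    rewrite size_map in ul.
    exact: (intersection_right le_order L_phi vsU occ lead_ev S_ev'
      amb na S_inclusion f1_0 G2 f2_0 sl e ul).
  apply: (inclusions_comb l1E l2E) => c e.
  exact: (inclusion_in_instance le_order L_phi occ lead_ev S_ev' amb na f1_0 G2 f2_0 sl e).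
- have [phi L vs h L_phi vsU occ lead_ev na vs0 S_ev f2E] := S_inst _ S2 f2_0.
  have [l sl] := lead_eG G1 f1_0.
  subst f2; have hf := lead_ev_neq0 lead_ev f2_0.
  have S_ev' h' := sub_S _ (S_ev h').
  have l2E := etrans (lead_monicize wo (ev phi h)) hf.
  have l1E := etrans (lead_monicize wo f1) sl.
  split.
    apply: (intersections_comb l1E l2E) => u v e _ vl.
    rewrite size_map in vl; rewrite e.
    have H := intersection_left le_order L_phi vsU occ lead_ev S_ev'
      amb na S_inclusion f2_0 G1 f1_0 sl e vl.
    by have := combN H; rewrite opprB.
  apply: (inclusions_comb l1E l2E) => c e.
  exact: (inclusion_of_instance le_order L_phi occ lead_ev S_ev' na vs0 f2_0 G1 f1_0 sl e).
exact: compositions_GG.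
Qed.

End Main.

Theorem theorem5p9 (K : fieldType) (X Z : choiceType)
    (Phi : {malg K[opmonom X]} -> Prop)
    (Phi_multilinear : forall phi, Phi phi ->
       exists n (x : n.-tuple X), multilinear_opi x phi)
    (leX : rel (opmonom X)) (leX_order : op_monomial_order leX)
    (I_A : {malg K[{fmonom Z}]} -> Prop) (I_A_ideal : is_ideal I_A)
    (le : rel (opmonom Z)) (le_order : op_monomial_order le)
    (Phi_GS : is_op_GS le (S_of (Z := Z) Phi))
    (G : {malg K[{fmonom Z}]} -> Prop)
    (G_GS : GS_basis_of (fun u v => le (emb u) (emb v)) G I_A)
    (lead_subword : forall phi, Phi phi ->
       forall v : {fmonom X}, (2 <= fdeg v)%N ->
         ~ subword (emb v) (lead leX phi))
    (lead_subst : forall phi n (x : n.-tuple X), Phi phi ->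
       multilinear_opi x phi ->
       forall u : n.-tuple (opmonom Z),
         opi_eval x phi u = 0 \/
         lead le (opi_eval x phi u) = mon_eval x (lead leX phi) u) :
  op_GS_basis_of le
    (fun f => S_of Phi f \/ emb_image G f)
    (operated_ideal_gen (@op_bracket K Z)
       (fun f => S_of Phi f \/ emb_image I_A f)).
Proof.
case: G_GS => G_GS' I_A_gen; split; last exact: operated_ideal_gen_emb.
apply: plugc_op_GS.
apply: (union_GS (op_order_plugc le_order) (op_GS_plugc Phi_GS) G_GS' (Phi := Phi)).
  by move=> f; apply: (instance_S_of leX_order lead_subword lead_subst).
by [].
Qed.
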